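(* 1. If $q\equiv-1\pmod 3$, then there are no h-planes. 2. If $q\not\equiv-1\pmod 3$, then every h-plane is of exactly one of the following two types. (a) ($\mathrm h_1$-plane) It lies in an $\mathbb H_{\mathrm I}$-5-space and contains exactly $q+1+\mathrm n$ fixed points, $q-\mathrm n$ I$_{\vdots}$-points and $q^2-q$ II$_{\vdots}$-points, and exactly $1$ ptwise-fixed line, $1$ fixed-I-line and $q-1+\mathrm n$ fixed-II-lines. There are $\mathrm g(\mathrm n+1)(q+1)(q^2+q+1)$ $\mathrm h_1$-planes. (b) ($\mathrm h_2$-plane) It contains exactly $q+1+\mathrm n$ fixed points and $q^2-\mathrm n$ II$_{\vdots}$-points, and exactly $1$ ptwise-fixed line and $q+\mathrm n$ fixed-II-lines. There are $\mathrm g(\mathrm n+1)(q^2+\mathrm n-1)(q^2+q+1)$ $\mathrm h_2$-planes.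
   Context: Let $q>2$ be a prime power, $\mathrm n\in\{-1,0,1\}$ with $q\equiv\mathrm n\pmod 3$, $\mathrm g=\gcd(3,q-1)$. Let $\phi$ be a collineation of $\mathrm{PG}(2,q^3)$ of order 3 fixing pointwise an $\mathbb F_q$-subplane $\mathcal P_{2,q}$. A point $\bar P$ of $\mathrm{PG}(2,q^3)$ has Type I if in $\mathcal P_{2,q}$, Type II if $\bar P,\bar P^\phi,\bar P^{\phi^2}$ are distinct and collinear; a Type-I-line meets $\mathcal P_{2,q}$ in $q+1$ points. Bose representation: identifying $\mathbb F_{q^3}^3$ with $\mathbb F_q^9$, each point $\bar P$ corresponds to a plane $[\![P]\!]$ of $\mathrm{PG}(8,q)$, each line to the 5-space spanned by the planes of its points ($\mathbb H_{\mathrm I}$-5-space if it is a Type-I-line). A point is an X-point if it lies in $[\![P]\!]$ with $\bar P$ of Type X. $\phi$ induces a projectivity $\sigma$ of $\mathrm{PG}(8,q)$ of order 3 with $[\![P]\!]^\sigma=[\![P^\phi]\!]$. A fixed point is a point fixed by $\sigma$; a I-point $A$ is a I$_{\vdots}$-point if $A,A^\sigma,A^{\sigma^2}$ are distinct and collinear; a II-point $B$ is a II$_{\vdots}$-point if $B,B^\sigma,B^{\sigma^2}$ are collinear. A ptwise-fixed line is a line fixed pointwise by $\sigma$; a fixed-I-line (fixed-II-line) is a $\sigma$-fixed line containing a I$_{\vdots}$-point (II$_{\vdots}$-point). A hwise-fixed-5-space is a 5-space $\Pi$ such that every 6-space containing $\Pi$ is fixed by $\sigma$. An h-plane is a $\sigma$-fixed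 plane contained in a hwise-fixed-5-space that is not fixed pointwise by $\sigma$.
   Formalization: The projectivity σ is required to have a linear representative whose cube is the identity; for q≡1 (mod 3), other order-3 projectivities satisfying [[P]]^σ=[[P^φ]] fix no point, so they have no h-planes and the stated counts fail for them. *)

(* Defs.v *)
From HB Require Import structures.
From mathcomp Require Import all_boot all_order all_algebra all_field.
Set Implicit Arguments.
Unset Strict Implicit.
Unset Printing Implicit Defensive.
Import Order.TTheory GRing.Theory Num.Theory.
Local Open Scope ring_scope.

Definition has_card (T : eqType) (P : T -> Prop) (N : int) : Prop :=
  exists s : seq T,
    [/\ uniq s, forall x, x \in s <-> P x & (size s)%:Z = N].

(* PG(d, K) is the lattice of subspaces of K^(d+1), so a projective dimension
   is one less than \dim. *)
Definition proj_dim (K : fieldType) (V : vectType K) (d : nat)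
  (U : {vspace V}) : Prop := \dim U = d.+1.

Notation is_point := (proj_dim 0).
Notation is_line := (proj_dim 1).
Notation is_plane := (proj_dim 2).

Definition collinear (K : fieldType) (V : vectType K)
  (A B C : {vspace V}) : Prop :=
  exists l : {vspace V},
    is_line l /\ [/\ (A <= l)%VS, (B <= l)%VS & (C <= l)%VS].

Definition distinct3 (T : Type) (x y z : T) : Prop :=
  [/\ x <> y, y <> z & x <> z].

Definition collineation (K : fieldType) (V : vectType K)
  (phi : {vspace V} -> {vspace V}) : Prop :=
  bijective phi /\ {mono phi : U W / (U <= W)%VS}.

Definition collineation_order3 (K : fieldType) (V : vectType K)
  (phi : {vspace V} -> {vspace V}) : Prop :=
  (forall U, phi (phi (phi U)) = U) /\ (exists U, phi U <> U).

(* The images of PG(2, F) under PGL(3, L). *)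
Definition Fq_subplane (F : finFieldType) (L : fieldExtType F)
  (P2q : {vspace 'rV[L]_3} -> Prop) : Prop :=
  exists2 B : 'M[L]_3, B \in unitmx &
    forall P, P2q P <->
      exists2 a : 'rV[F]_3, a != 0 & P = <[map_mx (in_alg L) a *m B]>%VS.

Definition type_II (F : finFieldType) (L : fieldExtType F)
  (phi : {vspace 'rV[L]_3} -> {vspace 'rV[L]_3}) (P : {vspace 'rV[L]_3}) :=
  [/\ is_point P, distinct3 P (phi P) (phi (phi P))
    & collinear P (phi P) (phi (phi P))].

Definition type_I_line (F : finFieldType) (L : fieldExtType F)
  (P2q : {vspace 'rV[L]_3} -> Prop) (l : {vspace 'rV[L]_3}) : Prop :=
  is_line l /\ has_card (fun P => P2q P /\ (P <= l)%VS) (#|F|%:Z + 1).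

(* An identification of L^3 with F^9: an F-linear bijection, where 'rV[L]_3 is
   an F-space through the embedding a |-> a%:A of F in L. *)
Definition F_identification (F : finFieldType) (L : fieldExtType F)
  (beta : 'rV[L]_3 -> 'rV[F]_9) : Prop :=
  bijective beta /\
  (forall (a : F) (u v : 'rV[L]_3),
     beta (a%:A *: u + v) = a *: beta u + beta v).

(* The image under beta of the L-subspace U. It is a plane of PG(8, F) when U
   is a point, and when U is a line it is the 5-space spanned by the planes of
   the points of U. *)
Definition bose (F : finFieldType) (L : fieldExtType F)
  (beta : 'rV[L]_3 -> 'rV[F]_9) (U : {vspace 'rV[L]_3}) : {vspace 'rV[F]_9} :=
  <<[seq beta (c *: u) | c <- vbasis {:L}, u <- vbasis U]>>%VS.

Definition HI_5space (F : finFieldType) (L : fieldExtType F)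
  (P2q : {vspace 'rV[L]_3} -> Prop) (beta : 'rV[L]_3 -> 'rV[F]_9)
  (Pi : {vspace 'rV[F]_9}) : Prop :=
  exists2 l, type_I_line P2q l & Pi = bose beta l.

Definition fixed (F : finFieldType) (s : 'End('rV[F]_9))
  (U : {vspace 'rV[F]_9}) : Prop := (s @: U)%VS = U.

(* s is a linear representative of the projectivity sigma. The condition that
   sigma maps the plane of P to the plane of P^phi determines s only up to a
   factor lambda in L^*, and then s^3 is always a scalar of F^*. The sigma
   induced by phi is the one which in coordinates adapted to the fixed subplane
   is x |-> x^q (or x |-> x^(q^2)), up to conjugacy: this is the case where
   s^3 is the cube of a scalar, so that s can be scaled to have s^3 = 1. When
   s^3 is not such a cube, which can happen only for q = 1 mod 3, sigma fixes
   no point of PG(8, q). *)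
Definition projectivity_order3 (F : finFieldType)
  (s : 'End('rV[F]_9)) : Prop :=
  (s \o s \o s)%VF = \1%VF /\ (exists2 A, is_point A & ~ fixed s A).

Definition induced_by (F : finFieldType) (L : fieldExtType F)
  (beta : 'rV[L]_3 -> 'rV[F]_9)
  (phi : {vspace 'rV[L]_3} -> {vspace 'rV[L]_3})
  (s : 'End('rV[F]_9)) : Prop :=
  forall P, is_point P -> (s @: bose beta P)%VS = bose beta (phi P).

Definition I_point (F : finFieldType) (L : fieldExtType F)
  (P2q : {vspace 'rV[L]_3} -> Prop) (beta : 'rV[L]_3 -> 'rV[F]_9)
  (A : {vspace 'rV[F]_9}) : Prop :=
  is_point A /\ exists2 P, P2q P & (A <= bose beta P)%VS.

Definition II_point (F : finFieldType) (L : fieldExtType F)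
  (phi : {vspace 'rV[L]_3} -> {vspace 'rV[L]_3})
  (beta : 'rV[L]_3 -> 'rV[F]_9) (B : {vspace 'rV[F]_9}) : Prop :=
  is_point B /\ exists2 P, type_II phi P & (B <= bose beta P)%VS.

Definition fixed_point (F : finFieldType) (s : 'End('rV[F]_9))
  (A : {vspace 'rV[F]_9}) : Prop := is_point A /\ fixed s A.

Definition Idots_point (F : finFieldType) (L : fieldExtType F)
  (P2q : {vspace 'rV[L]_3} -> Prop) (beta : 'rV[L]_3 -> 'rV[F]_9)
  (s : 'End('rV[F]_9)) (A : {vspace 'rV[F]_9}) : Prop :=
  [/\ I_point P2q beta A, distinct3 A (s @: A)%VS (s @: (s @: A))%VS
    & collinear A (s @: A)%VS (s @: (s @: A))%VS].

Definition IIdots_point (F : finFieldType) (L : fieldExtType F)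
  (phi : {vspace 'rV[L]_3} -> {vspace 'rV[L]_3})
  (beta : 'rV[L]_3 -> 'rV[F]_9) (s : 'End('rV[F]_9))
  (B : {vspace 'rV[F]_9}) : Prop :=
  II_point phi beta B /\ collinear B (s @: B)%VS (s @: (s @: B))%VS.

Definition ptwise_fixed (F : finFieldType) (s : 'End('rV[F]_9))
  (U : {vspace 'rV[F]_9}) : Prop :=
  forall A, is_point A -> (A <= U)%VS -> fixed s A.

Definition ptwise_fixed_line (F : finFieldType) (s : 'End('rV[F]_9))
  (l : {vspace 'rV[F]_9}) : Prop := is_line l /\ ptwise_fixed s l.

Definition fixed_I_line (F : finFieldType) (L : fieldExtType F)
  (P2q : {vspace 'rV[L]_3} -> Prop) (beta : 'rV[L]_3 -> 'rV[F]_9)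
  (s : 'End('rV[F]_9)) (l : {vspace 'rV[F]_9}) : Prop :=
  [/\ is_line l, fixed s l
    & exists2 A, Idots_point P2q beta s A & (A <= l)%VS].

Definition fixed_II_line (F : finFieldType) (L : fieldExtType F)
  (phi : {vspace 'rV[L]_3} -> {vspace 'rV[L]_3})
  (beta : 'rV[L]_3 -> 'rV[F]_9) (s : 'End('rV[F]_9))
  (l : {vspace 'rV[F]_9}) : Prop :=
  [/\ is_line l, fixed s l
    & exists2 B, IIdots_point phi beta s B & (B <= l)%VS].

Definition hwise_fixed_5space (F : finFieldType) (s : 'End('rV[F]_9))
  (Pi : {vspace 'rV[F]_9}) : Prop :=
  proj_dim 5 Pi /\
  (forall Sg, proj_dim 6 Sg -> (Pi <= Sg)%VS -> fixed s Sg).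

Definition h_plane (F : finFieldType) (s : 'End('rV[F]_9))
  (U : {vspace 'rV[F]_9}) : Prop :=
  [/\ is_plane U, fixed s U, ~ ptwise_fixed s U
    & exists2 Pi, hwise_fixed_5space s Pi & (U <= Pi)%VS].

Definition contains_exactly (F : finFieldType) (U : {vspace 'rV[F]_9})
  (Q : {vspace 'rV[F]_9} -> Prop) (N : int) : Prop :=
  has_card (fun A => Q A /\ (A <= U)%VS) N.

Definition h1_plane (F : finFieldType) (L : fieldExtType F)
  (P2q : {vspace 'rV[L]_3} -> Prop)
  (phi : {vspace 'rV[L]_3} -> {vspace 'rV[L]_3})
  (beta : 'rV[L]_3 -> 'rV[F]_9) (s : 'End('rV[F]_9))
  (n : int) (U : {vspace 'rV[F]_9}) : Prop :=
  let q := #|F|%:Z in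
  h_plane s U /\
  (exists2 Pi, HI_5space P2q beta Pi & (U <= Pi)%VS) /\
  [/\ contains_exactly U (fixed_point s) (q + 1 + n),
      contains_exactly U (Idots_point P2q beta s) (q - n)
    & contains_exactly U (IIdots_point phi beta s) (q ^+ 2 - q)] /\
  [/\ contains_exactly U (ptwise_fixed_line s) 1,
      contains_exactly U (fixed_I_line P2q beta s) 1
    & contains_exactly U (fixed_II_line phi beta s) (q - 1 + n)].

Definition h2_plane (F : finFieldType) (L : fieldExtType F)
  (phi : {vspace 'rV[L]_3} -> {vspace 'rV[L]_3})
  (beta : 'rV[L]_3 -> 'rV[F]_9) (s : 'End('rV[F]_9))
  (n : int) (U : {vspace 'rV[F]_9}) : Prop :=
  let q := #|F|%:Z in
  h_plane s U /\
  [/\ contains_exactly U (fixed_point s) (q + 1 + n)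
    & contains_exactly U (IIdots_point phi beta s) (q ^+ 2 - n)] /\
  [/\ contains_exactly U (ptwise_fixed_line s) 1
    & contains_exactly U (fixed_II_line phi beta s) (q + n)].

(* Main.v *)
Require Import Defs.
From HB Require Import structures.
From mathcomp Require Import all_boot all_order all_algebra all_field.
From mathcomp Require Import ring zify.
Set Implicit Arguments.
Unset Strict Implicit.
Unset Printing Implicit Defensive.
Import Order.TTheory GRing.Theory Num.Theory.
Local Open Scope ring_scope.

(** Transported to L^3, s is additive and maps L-lines to L-lines, so it is
    semilinear for some th in Gal(L/F) of order 3. It fixes the points of the
    subplane, so in a suitable basis it is x |-> l x^th, and since l has norm 1,
    Hilbert 90 gives coordinates kappa with s (kappa v) = kappa (v^th).
    As the fixed field of th is F, every eigenspace of s has dimension 3, and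
    the hwise-fixed 5-spaces are the images of s - la for the eigenvalues la.
    Hence s satisfies a quadratic equation (s - mu)(s - nu) = 0 on an h-plane.
    If q = -1 mod 3, that equation is irreducible, which is impossible on a space
    of odd dimension. Otherwise let eps, alp in L be such that th eps = mu eps and
    th alp = nu alp + dl eps, where dl = 1 and mu = nu = 1 (Artin-Schreier) if
    q = 0 mod 3, while dl = 0 and mu, nu are distinct cube roots of unity (Kummer)
    if q = 1 mod 3. Up to GL(3, F) an h-plane is then spanned by
      eps e1, eps e2, alp e1                                    (type h1), or by
      eps e1, eps e2 and either alp e3 (dl = 0) or alp e1 + eps e3 (dl = 1)
                                                                (type h2).
    The points and lines in it are counted in these coordinates, and the planes
    by the stabilizers in GL(3, F). *)

(** * Counting by constant fibres, and the automorphism of L *)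

(** Since [s^3 = 1] and an h-plane lies in the image of [s - la], the polynomial
    [(X^3 - 1) / (X - la)] vanishes at [s] on that plane: this is the quadratic equation, and [mu],
    [nu] are the two other roots of [X^3 - 1], with multiplicity. In L^3, seen as the tensor product
    of L and F^3 over F, [s] is [th] tensor the identity. Hence GL(3, F) commutes with [s] and
    respects all the notions of point and line involved, and the statistics need only be found in
    one plane of each type. If mu <> nu, an h-plane is the sum of an eigenspace c tensor A, with A
    of dimension 2 in F^3, and one more eigenvector d tensor b; it has type h1 if b lies in A and
    type h2 otherwise. So it is a flag or an antiflag of PG(2, q) together with an ordered pair of
    distinct cube roots of unity. The 6 such pairs are the factor g (n + 1), which is 1 when q = 0
    mod 3, where there is only one frame. All counts use parametrizations, by vectors or matrices,
    whose fibres have constant size. *)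

Section HasCard.
Variable T : eqType.
Implicit Type P : T -> Prop.

Lemma has_card_inj P N N' : has_card P N -> has_card P N' -> N = N'.
Proof.
move=> [s [us Ps <-]] [s' [us' Ps' <-]]; congr Posz; apply: perm_size.
by apply: uniq_perm => // x; apply/idP/idP => [/Ps/Ps'|/Ps'/Ps].
Qed.

(** Double counting: the list of all [f i] with i in D repeats each element of P exactly k times, so
    its length is k times the number of distinct values, and k > 0 can be cancelled. *)
Lemma has_card_fiber (I : finType) (f : I -> T) (D : {set I}) P (k N : nat) :
    (0 < k)%N -> (forall x, P x <-> exists2 i, i \in D & f i = x) ->
    (forall i, i \in D -> #|[set j in D | f j == f i]| = k) ->
  #|D| = (N * k)%N -> has_card P N%:Z.
Proof.
move=> k0 Pf fib DNk; pose t := [seq f i | i <- enum D].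
exists (undup t); split; first exact: undup_uniq.
  move=> x; rewrite mem_undup; split.
    by case/mapP=> i; rewrite mem_enum => iD ->; apply/Pf; exists i.
  by case/Pf=> i iD <-; apply: map_f; rewrite mem_enum.
congr Posz; have := perm_size (perm_count_undup t).
rewrite size_flatten /shape -map_comp size_map -cardE DNk => sizeE.
suff: sumn [seq (size \o (fun x => nseq (count_mem x t) x)) i | i <- undup t]
   = (size (undup t) * k)%N.
  by rewrite sizeE => /eqP; rewrite eqn_pmul2r // => /eqP.
rewrite sumnE big_map big_seq (eq_bigr (fun=> k)); last first.
  move=> x /=; rewrite size_nseq mem_undup => /mapP[i]; rewrite mem_enum => iD ->.
  rewrite count_map -(fib i iD) cardE -size_filter /enum_mem -filter_predI.
  by congr size; apply: eq_filter => j /=; rewrite !inE andbC.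
by rewrite -big_seq big_const_seq count_predT iter_addn_0 mulnC.
Qed.

End HasCard.

Section Row3.
Variable R : nzRingType.
Definition o0 : 'I_3 := @Ordinal 3 0 isT.
Definition o1 : 'I_3 := @Ordinal 3 1 isT.
Definition o2 : 'I_3 := @Ordinal 3 2 isT.
Definition vec3 (x y z : R) : 'rV[R]_3 := \row_(i < 3) [:: x; y; z]`_i.

Lemma vec3E0 x y z : vec3 x y z 0 o0 = x. Proof. by rewrite mxE. Qed.
Lemma vec3E1 x y z : vec3 x y z 0 o1 = y. Proof. by rewrite mxE. Qed.
Lemma vec3E2 x y z : vec3 x y z 0 o2 = z. Proof. by rewrite mxE. Qed.
Definition vec3E := (vec3E0, vec3E1, vec3E2).

Lemma ord3P (P : 'I_3 -> Prop) : P o0 -> P o1 -> P o2 -> forall i, P i.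
Proof.
move=> P0 P1 P2 [[|[|[|//]]] lti].
- by rewrite (_ : Ordinal lti = o0) //; apply: val_inj.
- by rewrite (_ : Ordinal lti = o1) //; apply: val_inj.
- by rewrite (_ : Ordinal lti = o2) //; apply: val_inj.
Qed.

Lemma row3P (v w : 'rV[R]_3) :
  v 0 o0 = w 0 o0 -> v 0 o1 = w 0 o1 -> v 0 o2 = w 0 o2 -> v = w.
Proof. by move=> e0 e1 e2; apply/rowP; apply: ord3P. Qed.

Lemma vec3_eta (v : 'rV[R]_3) : v = vec3 (v 0 o0) (v 0 o1) (v 0 o2).
Proof. by apply: row3P; rewrite vec3E. Qed.

Lemma vec3_inj x y z x' y' z' :
  vec3 x y z = vec3 x' y' z' -> [/\ x = x', y = y' & z = z'].
Proof.
move=> e; split; [have := congr1 (fun v : 'rV_3 => v 0 o0) e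
  | have := congr1 (fun v : 'rV_3 => v 0 o1) e
  | have := congr1 (fun v : 'rV_3 => v 0 o2) e]; by rewrite !vec3E.
Qed.

Lemma vec3_0 : vec3 0 0 0 = 0.
Proof. by apply: row3P; rewrite vec3E mxE. Qed.

Lemma vec3D x y z x' y' z' :
  vec3 x y z + vec3 x' y' z' = vec3 (x + x') (y + y') (z + z').
Proof. by apply: row3P; rewrite [LHS]mxE !vec3E. Qed.

Lemma vec3Z a x y z : a *: vec3 x y z = vec3 (a * x) (a * y) (a * z).
Proof. by apply: row3P; rewrite [LHS]mxE !vec3E. Qed.

Lemma sum3 (V : nmodType) (f : 'I_3 -> V) :
  \sum_(i < 3) f i = f o0 + f o1 + f o2.
Proof.
by rewrite !big_ord_recl big_ord0 addr0 addrA; congr (f _ + f _ + f _); apply: val_inj.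
Qed.
End Row3.

Lemma map_vec3 (R S : nzRingType) (f : R -> S) x y z :
  map_mx f (vec3 x y z) = vec3 (f x) (f y) (f z).
Proof. by apply: row3P; rewrite mxE !vec3E. Qed.

(** * Galois theory of the cubic extension L of F *)

Section Automorphism.
Variables (F : finFieldType) (L : fieldExtType F) (th : {lrmorphism L -> L}).
Hypothesis hL : \dim {:L}%VS = 3%N.
Hypothesis th3 : forall x, th (th (th x)) = x.
Hypothesis th_nt : exists x, th x != x.

Lemma th_alg a : th a%:A = a%:A. Proof. exact: rmorph_alg. Qed.

(** The degree 3 leaves no room for an intermediate field: if x outside F were fixed and y is moved,
    then 1, x, y, x y would be four independent elements of L over F. *)
Lemma th_fixed x : th x = x -> exists a, x = a%:A.
Proof.
move=> thx; case: th_nt => y thy.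
have [/vlineP|xF] := boolP (x \in <[1 : L]>%VS); first by case=> a ->; exists a.
suff : free [:: 1; x; y; x * y].
  by move=> fr; have := dimvS (subvf <<[:: 1; x; y; x * y]>>);
     rewrite (eqP fr) hL.
have th_comb a b : th (a *: 1 + b *: x) = a *: 1 + b *: x.
  by rewrite linearP linearZ /= thx rmorph1.
have xF_free a b : a *: 1 + b *: x = 0 -> a = 0 /\ b = 0.
  have [->|b0] := eqVneq b 0.
    rewrite scale0r addr0 => /eqP; rewrite scaler_eq0 oner_eq0 orbF.
    by move/eqP.
  move=> e; case/negP: xF; apply/vlineP; exists (- b^-1 * a).
  apply: (scalerI b0); rewrite scalerA mulrA mulrN divff // mulN1r scaleNr.
  by apply/eqP; rewrite -addr_eq0 addrC e.
have yK a b c d : a *: 1 + b *: x + (c *: 1 + d *: x) * y = 0 ->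
   [/\ a = 0, b = 0, c = 0 & d = 0].
  (* Subtracting the relation from its image under [th], which fixes its coefficients, isolates the
     coefficient of y. *)
  move=> e; have e2 : (c *: 1 + d *: x) * (th y - y) = 0.
    have := congr1 th e; rewrite rmorph0 rmorphD rmorphM /= !th_comb => e'.
    rewrite mulrBr -[RHS](subrr 0) -{1}e' -e; ring.
  have := mulf_eq0 (c *: 1 + d *: x) (th y - y); rewrite e2 eqxx.
  rewrite subr_eq0 (negPf thy) orbF => /esym/eqP e3.
  move: (e); rewrite e3 mul0r addr0 => /xF_free[-> ->].
  by have [-> ->] := xF_free _ _ e3.
apply/(freeP (X := [tuple 1; x; y; x * y])) => k.
rewrite !big_ord_recl big_ord0 /= addr0 => e.
have [] := yK (k ord0) (k (lift ord0 ord0)) (k (lift ord0 (lift ord0 ord0)))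
              (k (lift ord0 (lift ord0 (lift ord0 ord0)))).
  by rewrite -[RHS]e mulrDl -!scalerAl mul1r !addrA.
move=> k0 k1 k2 k3 [[|[|[|[|//]]]] lti]; [rewrite -[RHS]k0|rewrite -[RHS]k1
  |rewrite -[RHS]k2|rewrite -[RHS]k3]; congr k; exact: val_inj.
Qed.

(** The quotient d / c is fixed by [th], so it lies in F. *)
Lemma th_eigen (m : F) c d :
  c != 0 -> th c = m *: c -> th d = m *: d -> exists a, d = a *: c.
Proof.
move=> c0 thc thd.
have m0 : m%:A != 0 :> L.
  apply/eqP => m0; move: thc; rewrite -mulr_algl m0 mul0r => /eqP.
  by rewrite fmorph_eq0 (negPf c0).
case: (@th_fixed (d / c)).
  by rewrite fmorph_div /= thc thd -(mulr_algl m c) -(mulr_algl m d) -mulf_div divff // mul1r.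
by move=> a e; exists a; rewrite -mulr_algl -e divfK.
Qed.

(* The witness is a Lagrange resolvent f x; not all of them vanish, by the
   independence of the characters 1, th and th^2. *)
Lemma th_hilbert90 l :
  l * th l * th (th l) = 1 -> exists2 c, c != 0 & l * th c = c.
Proof.
move=> Nl; case: th_nt => y thy.
have l0 : l != 0 by apply/eqP => l0; move/eqP: Nl; rewrite l0 !mul0r eq_sym oner_eq0.
have tl0 : th l != 0 by rewrite fmorph_eq0.
pose f x := x + l * th x + l * th l * th (th x).
have lf x : l * th (f x) = f x.
  rewrite /f !rmorphD !rmorphM /= th3.
  transitivity (l * th l * th (th l) * x + l * th x + l * th l * th (th x)).
    ring.
  by rewrite Nl mul1r.
have [f1|f1] := eqVneq (f 1) 0; last by exists (f 1).
have [fy|fy] := eqVneq (f y) 0; last by exists (f y).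
have [fy2|fy2] := eqVneq (f (th y)) 0; last by exists (f (th y)).
have [fy3|fy3] := eqVneq (f (y * th y)) 0; last by exists (f (y * th y)).
exfalso.
(* f (y * x) - y * f x, for x = 1 and x = th y, eliminates the first character. *)
have e1 : l * (th y - y) + l * th l * (th (th y) - y) = 0.
  rewrite -[RHS](subrr 0) -{1}fy -(mulr0 y) -f1 /f !rmorph1; ring.
have e2 : l * (th y - y) * th (th y) + l * th l * (th (th y) - y) * y = 0.
  rewrite -[RHS](subrr 0) -{1}fy3 -(mulr0 y) -fy2 /f !rmorphM /= th3; ring.
have : l * (th y - y) * (th (th y) - y) = 0.
  rewrite -[RHS](subrr 0) -{1}e2 -(mulr0 y) -e1; ring.
move/eqP; rewrite !mulf_eq0 (negPf l0) !subr_eq0 (negPf thy) /=.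
by move/eqP => e; case/eqP: thy; rewrite -{1}e th3.
Qed.

(** The element y = th x - x has trace 0, and [th^2 + th + 1 = (th - w)(th - w^2)]. So z = th y -
    w^2 y is an eigenvector for w unless it vanishes; in that case y has eigenvalue w^2, and y^2 has
    eigenvalue w^4 = w. *)
Lemma th_kummer (w : F) : w ^+ 2 + w + 1 = 0 -> w != 1 ->
  exists2 a, a != 0 & th a = w *: a.
Proof.
move=> w2 w1; case: th_nt => x thx.
have w3 : w ^+ 3 = 1.
  have e : w ^+ 3 - 1 = (w - 1) * (w ^+ 2 + w + 1) by ring.
  by apply/eqP; rewrite -subr_eq0 e w2 mulr0.
have ww : (w ^+ 2)%:A + w%:A + 1 = 0 :> L.
  by have := congr1 (in_alg L) w2; rewrite !rmorphD rmorph1 rmorph0.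
pose y := th x - x; pose z := th y - (w ^+ 2)%:A * y.
have y0 : y != 0 by rewrite subr_eq0.
have thz : th z = w%:A * z.
  have w4 : w%:A * (w ^+ 2)%:A = 1 :> L.
    by rewrite mulr_algl scalerA -exprS w3 scale1r.
  have s0 : th (th y) + th y + y = 0 by rewrite /y !rmorphB /= th3; ring.
  rewrite /z rmorphB rmorphM /= th_alg mulrBr mulrA w4 mul1r.
  have -> : th (th y) = - th y - y.
    by apply/eqP; rewrite -subr_eq0 -[X in _ == X]s0; apply/eqP; ring.
  have -> : w%:A = - (w ^+ 2)%:A - 1 :> L.
    by apply/eqP; rewrite -subr_eq0 -[X in _ == X]ww; apply/eqP; ring.
  ring.
have [z0|z0] := eqVneq z 0; last by exists z; rewrite // thz mulr_algl.
exists (y ^+ 2); first by rewrite expf_neq0.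
move/eqP: z0; rewrite subr_eq0 rmorphXn /= => /eqP ->.
by rewrite mulr_algl exprZn -exprM (exprD w 3 1) w3 mul1r expr1.
Qed.

(** In characteristic 3, [(th - 1)^3 = th^3 - 1 = 0]. So either x or th x - x is sent by [th - 1] to
    a nonzero fixed element, and dividing by that element turns it into 1. *)
Lemma th_artin_schreier : 3%:R = 0 :> F -> exists a, th a = a + 1.
Proof.
move=> c3; have c3L : 3%:R = 0 :> L.
  by rewrite -(rmorph_nat (in_alg L)) c3 rmorph0.
have AS x : th (th x - x) = th x - x -> th x != x -> exists a, th a = a + 1.
  move=> thy y0; exists (x / (th x - x)).
  rewrite fmorph_div /= thy -{1}(subrK x (th x)) mulrDl divff ?subr_eq0 //.
  by rewrite addrC.
case: th_nt => x thx.
have [/AS|] := eqVneq (th (th x - x)) (th x - x); first exact.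
move=> ne; apply: (AS (th x - x)) => //.
rewrite !rmorphB /= th3; apply/eqP; rewrite -subr_eq0; apply/eqP.
transitivity (3%:R * (th x - th (th x))); first ring.
by rewrite c3L mul0r.
Qed.

End Automorphism.

(** * Adapted coordinates *)

Lemma card_nz (F : finFieldType) : #|[set k : F | k != 0]| = (#|F| - 1)%N.
Proof.
rewrite subn1 -(cardC1 (0 : F)); apply: eq_card => k; by rewrite !inE.
Qed.

(** A point is represented by the q - 1 nonzero multiples of a vector, so the fibres of f on D are
    the orbits of F^*. *)
Lemma has_card_points (F : finFieldType) m (T : eqType) (f : 'rV[F]_m -> T)
    (D : {set 'rV[F]_m}) (P : T -> Prop) (N : nat) :
    0 \notin D -> (forall k v, k != 0 -> v \in D -> k *: v \in D) ->
    (forall k v, k != 0 -> f (k *: v) = f v) ->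
    (forall v w, v \in D -> w \in D -> f v = f w -> exists k, v = k *: w) ->
    (forall x, P x <-> exists2 v, v \in D & f v = x) ->
  #|D| = (N * (#|F| - 1))%N -> has_card P N%:Z.
Proof.
move=> D0 DZ fZ fE Pf; apply: has_card_fiber Pf _; first by rewrite subn_gt0 finNzRing_gt1.
move=> w wD; have w0 : w != 0 by apply: contraNneq D0 => <-.
rewrite -card_nz -(card_imset (f := fun k : F => k *: w)); last first.
  move=> k k' /eqP; rewrite -subr_eq0 -scalerBl scaler_eq0 (negPf w0) orbF.
  by rewrite subr_eq0 => /eqP.
apply: eq_card => v; rewrite !inE; apply/andP/imsetP.
  move=> [vD /eqP fvw]; have [k e] := fE _ _ vD wD fvw; exists k => //.
  by rewrite inE; apply: contraNneq D0 => k0; rewrite -(scale0r w) -k0 -e.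
by move=> [k]; rewrite inE => k0 ->; rewrite DZ // fZ.
Qed.

Lemma card_row3 (F : finFieldType) (p : F -> F -> F -> bool) :
  #|[set v : 'rV[F]_3 | p (v 0 o0) (v 0 o1) (v 0 o2)]| =
  #|[set z : F * F * F | p z.1.1 z.1.2 z.2]|.
Proof.
rewrite -[RHS](card_imset (f := fun z => vec3 z.1.1 z.1.2 z.2)); last first.
  by move=> [[x y] z] [[x' y'] z'] /vec3_inj /= [-> -> ->].
apply: eq_card => v; rewrite !inE; apply/idP/imsetP.
  move=> pv; exists (v 0 o0, v 0 o1, v 0 o2); first by rewrite inE.
  exact: vec3_eta.
by move=> [[[x y] z]]; rewrite inE /= => pz ->; rewrite !vec3E.
Qed.

Lemma line_eqP (K : fieldType) (V : vectType K) (v w : V) :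
  v != 0 -> reflect (<[v]> = <[w]>)%VS (v \in <[w]>%VS).
Proof.
move=> v0; apply: (iffP idP) => [vw|<-]; last exact: memv_line.
by apply/eqP; rewrite eqEdim -memvE vw !dim_vline v0 leq_b1.
Qed.

Lemma is_point_line (K : fieldType) (V : vectType K) (v : V) :
  is_point <[v]>%VS <-> v != 0.
Proof. by rewrite /proj_dim dim_vline; case: (v != 0). Qed.

Lemma is_pointP (K : fieldType) (V : vectType K) (A : {vspace V}) :
  is_point A <-> exists2 v, v != 0 & A = <[v]>%VS.
Proof.
split=> [dA|[v v0 ->]]; last exact/is_point_line.
have A0 : vpick A != 0 by rewrite vpick0 -dimv_eq0 dA.
exists (vpick A) => //; apply/esym/eqP.
by rewrite eqEdim -memvE memv_pick dA dim_vline A0.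
Qed.

Lemma dim_add_lines (K : fieldType) (V : vectType K) (v w : V) :
  v != 0 -> w \notin <[v]>%VS -> \dim (<[v]> + <[w]>) = 2%N.
Proof.
move=> v0 wv; have: free [:: w; v] by rewrite free_cons span_seq1 wv seq1_free.
by move/eqP; rewrite span_cons span_seq1 addvC.
Qed.

Lemma map_alg_scale (F : finFieldType) (L : fieldExtType F) m
    (x y : 'rV[F]_m) (k : L) : x != 0 ->
  map_mx (in_alg L) y = k *: map_mx (in_alg L) x -> exists a, k = a%:A.
Proof.
case/rV0Pn => i xi e; exists (y 0 i / x 0 i).
have /(congr1 (fun u : 'rV[L]_m => u 0 i)) := e; rewrite !mxE => ei.
have xi' : in_alg L (x 0 i) != 0 by rewrite fmorph_eq0.
by apply: (mulIf xi'); rewrite -ei -[_%:A]/(in_alg L _) -rmorphM divfK.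
Qed.

Section Identification.
Variables (F : finFieldType) (L : fieldExtType F).
Variable (beta : 'rV[L]_3 -> 'rV[F]_9).
Hypothesis hbeta : F_identification beta.

Lemma ident_inj : injective beta. Proof. exact: bij_inj hbeta.1. Qed.
Lemma ident0 : beta 0 = 0.
Proof.
have := hbeta.2 1 0 0; rewrite scaler0 add0r scale1r => /esym/eqP.
by rewrite -subr_eq0 addrK => /eqP.
Qed.
Lemma identZ a v : beta (a%:A *: v) = a *: beta v.
Proof. by rewrite -[_ *: v]addr0 hbeta.2 ident0 addr0. Qed.
Lemma identD u v : beta (u + v) = beta u + beta v.
Proof. by rewrite -[u in LHS]scale1r -{1}(scale1r (1 : L)) hbeta.2 scale1r. Qed.
Lemma ident_sum I (r : seq I) (f : I -> 'rV[L]_3) :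
  beta (\sum_(i <- r) f i) = \sum_(i <- r) beta (f i).
Proof. exact: (big_morph beta identD ident0). Qed.
Lemma ident_eq0 v : (beta v == 0) = (v == 0).
Proof. by rewrite -ident0 (inj_eq ident_inj). Qed.
Lemma ident_surj w : exists v, w = beta v.
Proof. by case: hbeta.1 => g _ bK; exists (g w). Qed.

(** The span is no larger than the image of U, since the generators come from U; it is no smaller,
    since each L-coefficient of v expands on the F-basis of L. *)
Lemma bose_mem U v : (beta v \in bose beta U) = (v \in U).
Proof.
case: hbeta.1 => binv bK vK; apply/idP/idP => [|vU].
  rewrite /bose; set X := (X in <<X>>%VS) => vX.
  have := coord_span (X := in_tuple X) vX.
  have XU i : binv (in_tuple X)`_i \in U.
    have [ltiX|leXi] := ltnP i (size X); last first.
      by rewrite nth_default // -ident0 bK mem0v.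
    have /allpairsP[[c u] /= [_ uU ->]] := mem_nth 0 ltiX.
    by rewrite bK memvZ // vbasis_mem.
  rewrite (eq_bigr (fun i => beta ((coord (in_tuple X) i (beta v))%:A *: binv (in_tuple X)`_i))).
    by rewrite -ident_sum => /ident_inj ->; apply: memv_suml => i _; rewrite memvZ.
  by move=> i _; rewrite identZ vK.
rewrite (coord_vbasis vU) ident_sum; apply: memv_suml => i _.
rewrite {1}(coord_vbasis (memvf (coord (vbasis U) i v))) scaler_suml ident_sum.
apply: memv_suml => j _; rewrite -mulr_algl -scalerA identZ memvZ //.
apply: memv_span; apply/allpairsP; exists ((vbasis {:L})`_j, (vbasis U)`_i).
by split=> //=; apply: mem_nth; rewrite size_tuple.
Qed.

End Identification.

(** Gathers what the counting uses of [phi], [beta] and the subplane. A I-point is an L-multiple of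
    a vector over F; [ad_II] asks that v and v^th be independent over L while v, v^th, v^(th^2) are
    dependent; [ad_H] concerns the line of PG(2, q^3) spanned by the first two rows of N. It runs
    over all N in GL(3, F) so that the record is stable under this group. *)
Record adapted (F : finFieldType) (L : fieldExtType F)
  (P2q : {vspace 'rV[L]_3} -> Prop) (phi : {vspace 'rV[L]_3} -> {vspace 'rV[L]_3})
  (beta : 'rV[L]_3 -> 'rV[F]_9) (s : 'End('rV[F]_9)) (th : {lrmorphism L -> L})
  (kappa : 'rV[L]_3 -> 'rV[F]_9) : Prop := Adapted {
  ad_ident : F_identification kappa;
  ad_s : forall v, s (kappa v) = kappa (map_mx th v);
  ad_I : forall v, I_point P2q beta <[kappa v]>%VS <->
    v != 0 /\ exists c (a : 'rV[F]_3), v = c *: map_mx (in_alg L) a;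
  ad_II : forall v k l, (forall c, map_mx th v <> c *: v) ->
    map_mx th (map_mx th v) = k *: v + l *: map_mx th v ->
    II_point phi beta <[kappa v]>%VS;
  ad_notI : forall A, II_point phi beta A -> ~ I_point P2q beta A;
  ad_H : forall N : 'M[F]_3, N \in unitmx ->
    exists2 Pi, HI_5space P2q beta Pi &
    forall v : 'rV[L]_3, v 0 o2 = 0 -> kappa (v *m map_mx (in_alg L) N) \in Pi }.

Lemma map_th_alg (F : finFieldType) (L : fieldExtType F)
    (th : {lrmorphism L -> L}) m n (M : 'M[F]_(m, n)) :
  map_mx th (map_mx (in_alg L) M) = map_mx (in_alg L) M.
Proof. by apply/matrixP => i j; rewrite !mxE th_alg. Qed.

(** The entries of a matrix over F are fixed by [th], so multiplication by it commutes with [s] and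
    preserves the L-multiples of vectors over F. This carries the computations in a standard plane
    to all its images under GL(3, F). *)
Lemma adapted_mul (F : finFieldType) (L : fieldExtType F) P2q phi beta s
    (th : {lrmorphism L -> L}) kappa (M : 'M[F]_3) : M \in unitmx ->
  adapted P2q phi beta s th kappa ->
  adapted P2q phi beta s th (fun v => kappa (v *m map_mx (in_alg L) M)).
Proof.
move=> uM [id Ks KI KII KnI KH].
have uM' : map_mx (in_alg L) M \in unitmx by rewrite map_unitmx.
split=> //.
- split=> [|a u v]; last by rewrite mulmxDl -scalemxAl id.2.
  apply: bij_comp; first exact: id.1.
  by exists (fun v => v *m invmx (map_mx (in_alg L) M)); [exact: mulmxK|exact: mulmxKV].
- by move=> v; rewrite Ks map_mxM map_th_alg.
- move=> v; rewrite KI -(inj_eq (can_inj (mulmxK uM')) v 0) mul0mx; split=> -[v0].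
    case=> c [a e]; split=> //; exists c, (a *m invmx M).
    by rewrite map_mxM map_invmx scalemxAl -e mulmxK.
  case=> c [a e]; split=> //; exists c, (a *m M).
  by rewrite e -scalemxAl map_mxM.
- move=> v k l nv e; apply: (KII _ k l).
    move=> c; rewrite map_mxM map_th_alg scalemxAl.
    by move/(can_inj (mulmxK uM')) => /nv.
  by rewrite !map_mxM !map_th_alg e mulmxDl -!scalemxAl.
- move=> N uN; have uNM : N *m M \in unitmx by rewrite unitmx_mul uN.
  have [Pi HPi PiK] := KH _ uNM; exists Pi => // v v2.
  by rewrite -mulmxA -map_mxM PiK.
Qed.

(** * From the collineation to a semilinear map *)

Section AdaptedCoordinates.
Variables (F : finFieldType) (L : fieldExtType F)
  (P2q : {vspace 'rV[L]_3} -> Prop) (phi : {vspace 'rV[L]_3} -> {vspace 'rV[L]_3})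
  (B : 'M[L]_3).
Hypotheses (uB : B \in unitmx) (P2qB : forall P, P2q P <->
      exists2 a : 'rV[F]_3, a != 0 & P = <[map_mx (in_alg L) a *m B]>%VS)
  (hphi : collineation phi) (hphi3 : collineation_order3 phi)
  (hfix : forall P, P2q P -> phi P = P).
Variables (beta : 'rV[L]_3 -> 'rV[F]_9) (hbeta : F_identification beta)
  (s : 'End('rV[F]_9)) (hs3 : (s \o s \o s)%VF = \1%VF)
  (hs : induced_by beta phi s).

Lemma s_cubed w : s (s (s w)) = w.
Proof. by have /lfunP/(_ w) := hs3; rewrite !comp_lfunE id_lfunE. Qed.

Lemma collineation0 : phi 0%VS = 0%VS.
Proof.
case: hphi => -[g gK Kg] mono; apply/eqP; rewrite -subv0 -{2}(Kg 0%VS) mono.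
exact: sub0v.
Qed.

(** One vector suffices: <t> lies in phi <v>, so its preimage under [phi] lies in the point <v>, and
    it is not 0 because [phi] fixes 0. *)
Lemma collineation_line v t : s (beta v) = beta t -> phi <[v]>%VS = <[t]>%VS.
Proof.
move=> svt; have [v0|v0] := eqVneq v 0.
  move: svt; rewrite v0 (ident0 hbeta) linear0 => /esym/eqP.
  by rewrite (ident_eq0 hbeta) => /eqP ->; exact: collineation0.
have t0 : t != 0.
  apply: contraNneq v0 => t0; rewrite -(ident_eq0 hbeta) -(s_cubed (beta v)) svt.
  by rewrite t0 (ident0 hbeta) !linear0.
have tphi : t \in phi <[v]>%VS.
  rewrite -(bose_mem hbeta) -hs; last exact/is_point_line.
  by rewrite -svt memv_img // (bose_mem hbeta) memv_line.
case: hphi => -[g gK Kg] mono.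
move: tphi; rewrite memvE -{1}(Kg <[t]>%VS) mono => gt.
have dg : \dim (g <[t]>%VS) = 1%N.
  apply/eqP; rewrite eqn_leq; apply/andP; split.
    by rewrite (leq_trans (dimvS gt)) // dim_vline leq_b1.
  rewrite lt0n dimv_eq0; apply: contraNneq t0 => g0.
  by rewrite -memv0 -collineation0 -g0 Kg memv_line.
have -> : <[v]>%VS = g <[t]>%VS by apply/esym/eqP; rewrite eqEdim gt dg dim_vline v0.
exact: Kg.
Qed.

(** The fundamental theorem of projective geometry in a case where additivity is given, [s] being
    linear over F. The subplane contains the frame (1,0,0), (0,1,0), (0,0,1), (1,1,1); as its points
    are fixed, the three axes share one scalar [l] and one map [g]. *)
Lemma s_semilinear :
  exists (th : {lrmorphism L -> L}) (l : L), l != 0 /\ forall x,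
    s (beta (x *m B)) = beta (l *: (map_mx th x *m B)).
Proof.
case: hbeta.1 => binv bK vK.
pose T x := binv (s (beta (x *m B))) *m invmx B.
have sT x : s (beta (x *m B)) = beta (T x *m B) by rewrite /T mulmxKV // vK.
have Tlin a x y : T (a%:A *: x + y) = a%:A *: T x + T y.
  apply: (can_inj (mulmxK uB)); apply: (ident_inj hbeta).
  rewrite -sT mulmxDl -scalemxAl hbeta.2 linearP /= !sT.
  by rewrite mulmxDl -scalemxAl hbeta.2.
have TD x y : T (x + y) = T x + T y.
  by have := Tlin 1 x y; rewrite !scale1r.
have TZ a x : T (a%:A *: x) = a%:A *: T x.
  have T0 : T 0 = 0 by have /eqP := TD 0 0; rewrite addr0 -subr_eq subrr => /eqP.
  by have := Tlin a x 0; rewrite !addr0 T0 addr0.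
have TL c x : exists k, T (c *: x) = k *: T x.
  have : (<[(c *: x) *m B]> <= <[x *m B]>)%VS.
    by rewrite -memvE -scalemxAl memvZ // memv_line.
  rewrite -hphi.2 !(collineation_line (sT _)) -memvE => /vlineP[k e].
  by exists k; apply: (can_inj (mulmxK uB)); rewrite e scalemxAl.
have Tfix (a : 'rV[F]_3) : a != 0 ->
    exists k, T (map_mx (in_alg L) a) = k *: map_mx (in_alg L) a.
  move=> a0; have /hfix : P2q <[map_mx (in_alg L) a *m B]>%VS by apply/P2qB; exists a.
  rewrite (collineation_line (sT _)) => e.
  have /vlineP[k e'] : T (map_mx (in_alg L) a) *m B \in <[map_mx (in_alg L) a *m B]>%VS.
    by rewrite -e memv_line.
  by exists k; apply: (can_inj (mulmxK uB)); rewrite e' scalemxAl.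
have Tfix3 x y z : vec3 x y z != 0 -> exists k,
    T (vec3 x%:A y%:A z%:A) = vec3 (k * x%:A) (k * y%:A) (k * z%:A).
  by move/Tfix => [k]; rewrite map_vec3 /= vec3Z => ->; exists k.
have vec_nz x y z : (x != 0) || (y != 0) || (z != 0) -> vec3 x y z != 0 :> 'rV[F]_3.
  by move=> nz; apply/eqP; rewrite -vec3_0 => /vec3_inj[x0 y0 z0]; move: nz; rewrite x0 y0 z0 !eqxx.
have nz100 : vec3 1 0 0 != 0 :> 'rV[F]_3 by apply: vec_nz; rewrite oner_neq0.
have nz010 : vec3 0 1 0 != 0 :> 'rV[F]_3 by apply: vec_nz; rewrite oner_neq0 orbT.
have nz001 : vec3 0 0 1 != 0 :> 'rV[F]_3 by apply: vec_nz; rewrite oner_neq0 orbT.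
have nz111 : vec3 1 1 1 != 0 :> 'rV[F]_3 by apply: vec_nz; rewrite oner_neq0.
have [l0] := Tfix3 _ _ _ nz100; have [l1] := Tfix3 _ _ _ nz010.
have [l2] := Tfix3 _ _ _ nz001; have [l] := Tfix3 _ _ _ nz111.
rewrite !scale1r !scale0r !mulr1 !mulr0 => e3 e2 e1 e0.
have sum_e x y z : vec3 x y z = vec3 x 0 0 + vec3 0 y 0 + vec3 0 0 z :> 'rV[L]_3.
  by rewrite !vec3D !addr0 !add0r.
have [ll0 ll1 ll2] : [/\ l0 = l, l1 = l & l2 = l].
  by apply: vec3_inj; rewrite sum_e -e0 -e1 -e2 -!TD -sum_e.
rewrite {}ll0 in e0; rewrite {}ll1 in e1; rewrite {}ll2 in e2.
have lnz : l != 0.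
  apply/eqP => l0'; have /eqP : T (vec3 1 0 0) *m B = 0.
    by rewrite e0 l0' vec3_0 mul0mx.
  rewrite -(ident_eq0 hbeta) -sT => /eqP e.
  have := s_cubed (beta (vec3 1 0 0 *m B)); rewrite e !linear0 => /esym/eqP.
  rewrite (ident_eq0 hbeta) => /eqP /(congr1 (mulmx^~ (invmx B))).
  rewrite mulmxK // mul0mx -vec3_0 => /vec3_inj[/eqP].
  by rewrite oner_eq0.
pose g c := (T (vec3 c 0 0)) 0 o0 / l.
have T0 c : T (vec3 c 0 0) = vec3 (l * g c) 0 0.
  have [k] := TL c (vec3 1 0 0); rewrite vec3Z e0 vec3Z !mulr1 !mulr0 /g => ->.
  by rewrite vec3E mulrCA divff // mulr1.
have [T1 T2] : (forall c, T (vec3 0 c 0) = vec3 0 (l * g c) 0) /\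
    (forall c, T (vec3 0 0 c) = vec3 0 0 (l * g c)).
  have T12 c : T (vec3 0 c 0) = vec3 0 (l * g c) 0 /\
     T (vec3 0 0 c) = vec3 0 0 (l * g c).
    have [k] := TL c (vec3 0 1 0); rewrite vec3Z e1 vec3Z !mulr1 !mulr0 => f1.
    have [k'] := TL c (vec3 0 0 1); rewrite vec3Z e2 vec3Z !mulr1 !mulr0 => f2.
    have [k''] := TL c (vec3 1 1 1); rewrite vec3Z e3 vec3Z !mulr1.
    rewrite sum_e !TD T0 f1 f2 -sum_e => /vec3_inj[-> -> ->] //.
  by split=> c; have [] := T12 c.
have TE x : T x = l *: map_mx g x.
  rewrite (vec3_eta x) map_vec3 vec3Z sum_e !TD T0 T1 T2 -sum_e //.
have gE c d : T (vec3 c d 0) = vec3 (l * g c) (l * g d) (l * g 0).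
  by rewrite TE map_vec3 vec3Z.
have g1 : g 1 = 1 by rewrite /g e0 vec3E divff.
have glin : linear g.
  move=> a x y; apply: (mulfI lnz).
  have := Tlin a (vec3 x 0 0) (vec3 y 0 0).
  rewrite vec3Z vec3D !mulr0 !addr0 !T0 vec3Z vec3D => /vec3_inj[].
  by rewrite !mulr_algl mulrDr -scalerAr => ->.
have gM : monoid_morphism g.
  (* The second entry of the image of c (d, 1, 0) shows that the factor k is g c; the first entry
     then gives g (c d) = g c g d. *)
  split=> // c d; have [k] := TL c (vec3 d 1 0).
  rewrite vec3Z mulr0 mulr1 !gE vec3Z g1 => /vec3_inj[].
  rewrite mulr1 => e /eqP; rewrite mulrC (inj_eq (mulIf lnz)) => /eqP ek _.
  by apply: (mulfI lnz); rewrite e ek mulrCA.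
pose th : {lrmorphism L -> L} := HB.pack g (GRing.isLinear.Build F L L *:%R g glin)
   (GRing.isMonoidMorphism.Build L L g gM).
exists th, l; split=> // x; rewrite sT TE -scalemxAl //.
Qed.

(** A nonzero vector spans only one point of PG(2, q^3), and [phi] fixes that point if it has Type I
    but moves it if it has Type II. *)
Lemma IIpoint_not_Ipoint A : II_point phi beta A -> ~ I_point P2q beta A.
Proof.
move=> [/is_pointP[w w0 ->] [P [/is_pointP[u u0 ->] [phiP _ _] _]]].
rewrite -memvE => wu [_ [P' P'q]]; rewrite -memvE; have := P'q.
case/P2qB => a a0 eP'; rewrite eP' => wP'.
have [v e] := ident_surj hbeta w; move: wu wP'.
rewrite e !(bose_mem hbeta).
have v0 : v != 0 by rewrite -(ident_eq0 hbeta) -e.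
move=> /(line_eqP _ v0) e1 /(line_eqP _ v0) e2.
by apply: phiP; rewrite -e1 e2 -eP' hfix.
Qed.

(** A point of the subplane lies on [l] exactly when its F-coordinates with respect to N end in 0,
    which leaves (q^2 - 1) / (q - 1) = q + 1 points. *)
Lemma type_I_line_span (N : 'M[F]_3) (M := map_mx (in_alg L) N *m B)
    (l := (<[row o0 M]> + <[row o1 M]>)%VS) : N \in unitmx -> type_I_line P2q l.
Proof.
move=> uN; have uM : M \in unitmx by rewrite unitmx_mul map_unitmx uN.
have lP v : reflect (exists k0 k1, v = vec3 k0 k1 0 *m M) (v \in l).
  have mulE k0 k1 : vec3 k0 k1 0 *m M = k0 *: row o0 M + k1 *: row o1 M.
    by rewrite mulmx_sum_row sum3 !vec3E scale0r addr0.
  apply: (iffP memv_addP).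
    move=> [_ /vlineP[k0 ->] [_ /vlineP[k1 ->] ->]].
    by exists k0, k1; rewrite mulE.
  move=> [k0 [k1 ->]]; exists (k0 *: row o0 M); first by rewrite memvZ ?memv_line.
  by exists (k1 *: row o1 M); [rewrite memvZ ?memv_line | rewrite mulE].
have rowE0 : row o0 M = vec3 1 0 0 *m M.
  by rewrite mulmx_sum_row sum3 !vec3E !scale0r !addr0 scale1r.
have rowE1 : row o1 M = vec3 0 1 0 *m M.
  by rewrite mulmx_sum_row sum3 !vec3E !scale0r addr0 add0r scale1r.
split.
  apply: dim_add_lines.
    apply/eqP => /(congr1 (mulmx^~ (invmx M))).
    rewrite rowE0 mulmxK // mul0mx -vec3_0 => /vec3_inj[/eqP].
    by rewrite oner_eq0.
  apply/negP => /vlineP[k]; rewrite rowE0 rowE1 scalemxAl.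
  move/(can_inj (mulmxK uM)); rewrite vec3Z => /vec3_inj[_ /eqP].
  by rewrite mulr0 oner_eq0.
pose f (v : 'rV[F]_3) := <[map_mx (in_alg L) v *m M]>%VS.
have fE v : f v = <[map_mx (in_alg L) (v *m N) *m B]>%VS.
  by rewrite /f map_mxM mulmxA.
rewrite -[1]/(1%N%:Z) -PoszD.
apply: (has_card_points (f := f)
  (D := [set v : 'rV[F]_3 | ((v 0 o0 != 0) || (v 0 o1 != 0)) && (v 0 o2 == 0)])).
- by rewrite inE !mxE eqxx.
- move=> k v k0; rewrite !inE !mxE !mulf_eq0 (negPf k0) //=.
- move=> k v k0; rewrite /f map_mxZ -scalemxAl /=; apply/eqP.
  rewrite eqEsubv -!memvE memvZ ?memv_line //=; apply/vlineP.
  exists (k%:A)^-1; rewrite scalerA mulVf ?scale1r //.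
  by rewrite -[_%:A]/(in_alg L k) fmorph_eq0.
- move=> v w vD wD e.
  have : map_mx (in_alg L) v *m M \in <[map_mx (in_alg L) w *m M]>%VS.
    by rewrite -[<[_]>%VS]/(f w) -e memv_line.
  case/vlineP => k; rewrite scalemxAl => /(can_inj (mulmxK uM)) e1.
  have w0 : w != 0 by apply: contraTneq wD => ->; rewrite inE !mxE eqxx.
  have [a ka] := map_alg_scale w0 e1; exists a.
  apply: (map_mx_inj (f := in_alg L)) => /=; rewrite e1 map_mxZ; congr (_ *: _).
  by rewrite ka.
- move=> P; split=> [[/P2qB[a a0 ->]]|[v vD <-]].
    rewrite -memvE => /lP[k0 [k1 e]].
    have e1 : map_mx (in_alg L) (a *m invmx N) = vec3 k0 k1 0.
      rewrite map_mxM map_invmx; apply: (can_inj (mulmxK uM)); rewrite -e.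
      by rewrite /M mulmxA mulmxKV ?map_unitmx.
    exists (a *m invmx N); last by rewrite fE mulmxKV.
    have a2 : (a *m invmx N) 0 o2 = 0.
      apply/eqP; rewrite -(fmorph_eq0 (in_alg L)); apply/eqP.
      by have /(congr1 (fun v : 'rV_3 => v 0 o2)) := e1; rewrite vec3E mxE.
    rewrite inE a2 eqxx andbT -negb_and; apply: contra a0 => /andP[/eqP a00 /eqP a10].
    apply/eqP; rewrite -(mulmxKV uN a) (vec3_eta (a *m _)) a00 a10 a2 vec3_0.
    by rewrite mul0mx.
  move: vD; rewrite inE => /andP[v0 /eqP v2]; split.
    apply/P2qB; exists (v *m N); last by rewrite fE.
    apply/eqP => /(congr1 (mulmx^~ (invmx N))); rewrite mulmxK // mul0mx => e.
    by move: v0; rewrite e !mxE eqxx.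
  rewrite /f -memvE; apply/lP; exists (in_alg L (v 0 o0)), (in_alg L (v 0 o1)).
  by rewrite {1}(vec3_eta v) map_vec3 v2 rmorph0.
rewrite (card_row3 (fun x y z => ((x != 0) || (y != 0)) && (z == 0))).
have -> : [set z : F * F * F | ((z.1.1 != 0) || (z.1.2 != 0)) && (z.2 == 0)]
   = setX [set~ (0, 0)] [set 0].
  by apply/setP => -[[x y] z]; rewrite !inE xpair_eqE negb_and.
rewrite cardsX cards1 cardsC1 card_prod muln1.
by have := finNzRing_gt1 F; move: #|F| => q q1; nia.
Qed.

Lemma adapted_exists : exists (th : {lrmorphism L -> L}) kappa,
  [/\ forall x, th (th (th x)) = x, exists x, th x != x
    & adapted P2q phi beta s th kappa].
Proof.
have [th [l [l0 sE]]] := s_semilinear.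
have sE3 x : s (s (s (beta (x *m B)))) =
   beta ((l * th l * th (th l)) *: map_mx th (map_mx th (map_mx th x)) *m B).
  rewrite sE scalemxAl sE scalemxAl sE scalemxAl; congr (beta (_ *m B)).
  rewrite !map_mxZ /= !scalerA; congr (_ *: _); ring.
have e3 (x : 'rV[L]_3) : (l * th l * th (th l)) *: map_mx th (map_mx th (map_mx th x)) = x.
  apply: (can_inj (mulmxK uB)); apply: (ident_inj hbeta).
  by rewrite -sE3 s_cubed.
(* [s^3 = 1] at the first basis vector gives the norm condition of Hilbert 90. *)
have Nl : l * th l * th (th l) = 1.
  have := e3 (vec3 1 0 0); rewrite !map_vec3 !rmorph1 vec3Z => /vec3_inj[].
  by rewrite mulr1.
have th3 x : th (th (th x)) = x.
  have := e3 (vec3 x 0 0); rewrite !map_vec3 vec3Z Nl => /vec3_inj[].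
  by rewrite mul1r.
(* If [th] were the identity, [s] would be multiplication by [l], and [phi] would fix all points and
   hence all subspaces. *)
have th_nt : exists x, th x != x.
  case: hphi3 => _ [U phiU].
  have [/existsP[i ni]|] := boolP [exists i : 'I_(dim L), th (vbasis {:L})`_i != (vbasis {:L})`_i].
    by exists (vbasis {:L})`_i.
  rewrite negb_exists => /forallP thb; case: phiU.
  have thid x : th x = x.
    rewrite {1}(coord_vbasis (memvf x)) linear_sum [RHS](coord_vbasis (memvf x)).
    apply: eq_bigr => i _; rewrite linearZ /=; congr (_ *: _).
    have := thb (cast_ord (dimvf L) i); rewrite negbK => /eqP //.
  have phi_line v : phi <[v]>%VS = <[v]>%VS.
    rewrite (@collineation_line _ (l *: v)).
      have [->|v0] := eqVneq v 0; first by rewrite scaler0.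
      by apply/line_eqP; rewrite ?scaler_eq0 ?negb_or ?l0 // memvZ ?memv_line.
    rewrite -[v in LHS](mulmxKV uB) sE; congr beta; congr (_ *: _).
    have -> : map_mx th (v *m invmx B) = v *m invmx B.
      by apply/matrixP => i j; rewrite mxE thid.
    by rewrite mulmxKV.
  apply/vspaceP => v; rewrite !memvE -{1}(phi_line v).
  by case: hphi => _ ->.
exists th; have [c c0 lc] := th_hilbert90 th3 th_nt Nl.
(* Since [l * th c = c], scaling the basis by c absorbs the factor [l]. *)
pose C := c *: B; have uC : C \in unitmx by rewrite unitmxZ ?unitfE.
pose kappa (v : 'rV[L]_3) := beta (v *m C).
have kZ a (v : 'rV[L]_3) : v *m (a *: B) = a *: (v *m B) by rewrite scalemxAr.
have Ks v : s (kappa v) = kappa (map_mx th v).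
  rewrite /kappa !kZ scalemxAl sE map_mxZ; congr beta.
  by rewrite -scalemxAl scalerA lc.
have phiE v : phi <[v *m C]>%VS = <[map_mx th v *m C]>%VS.
  exact: collineation_line (Ks v).
have lineC (v w : 'rV[L]_3) : v *m C \in <[w *m C]>%VS -> exists k, v = k *: w.
  by case/vlineP => k; rewrite scalemxAl => /(can_inj (mulmxK uC)) ->; exists k.
have id : F_identification kappa.
  split; last by move=> a u v; rewrite /kappa mulmxDl -scalemxAl hbeta.2.
  apply: bij_comp; first exact: hbeta.1.
  by exists (mulmx^~ (invmx C)); [exact: mulmxK|exact: mulmxKV].
exists kappa; split=> //; split=> //.
- move=> v; split.
    move=> [/is_point_line]; rewrite (ident_eq0 id) => v0 [P /P2qB[a a0 ->]].
    rewrite -memvE (bose_mem hbeta) kZ => /vlineP[k e]; split=> //.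
    exists (c^-1 * k), a; apply: (can_inj (mulmxK uB)); rewrite -scalemxAl -scalerA -e.
    by rewrite scalerA mulVf // scale1r.
  move=> [v0 [k [a e]]]; split; first by apply/is_point_line; rewrite (ident_eq0 id).
  exists <[map_mx (in_alg L) a *m B]>%VS.
    apply/P2qB; exists a => //; apply: contraNneq v0 => a0.
    by rewrite e a0 map_mx0 scaler0.
  by rewrite -memvE (bose_mem hbeta) kZ e -scalemxAl !memvZ // memv_line.
- move=> v k m nv e; have v0 : v != 0.
    by apply/eqP => v0; apply: (nv 0); rewrite v0 map_mx0 scaler0.
  have vC0 : v *m C != 0.
    by apply: contraNneq v0 => /(congr1 (mulmx^~ (invmx C))); rewrite mulmxK // mul0mx => ->.
  split; first by apply/is_point_line; rewrite (ident_eq0 id).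
  exists <[v *m C]>%VS; last by rewrite -memvE (bose_mem hbeta) memv_line.
  have ne : <[v *m C]>%VS <> phi <[v *m C]>%VS.
    move=> e1; have : map_mx th v *m C \in <[v *m C]>%VS.
      by rewrite e1 phiE memv_line.
    by case/lineC => d /nv.
  split; first exact/is_point_line.
    split=> //; first by move/(bij_inj hphi.1).
    by move=> e1; apply: ne; rewrite {2}e1 hphi3.1.
  exists (<[v *m C]> + <[map_mx th v *m C]>)%VS; split.
    by apply: dim_add_lines => //; apply/negP => /lineC[d /nv].
  rewrite !phiE addvSl addvSr; split=> //.
  rewrite -memvE e mulmxDl -!scalemxAl; apply: memv_add; exact/memvZ/memv_line.
- exact: IIpoint_not_Ipoint.
- move=> N uN; have := type_I_line_span uN; set l' := (_ + _)%VS => Il'.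
  exists (bose beta l'); first by exists l'.
  move=> v v2; rewrite (bose_mem hbeta) -mulmxA /C -!scalemxAr (mulmx_sum_row v) sum3 v2 scale0r addr0.
  by rewrite memvZ // memv_add // memvZ // memv_line.
Qed.
End AdaptedCoordinates.

(** * Planes in coordinates *)

Section Span3.
Variables (K : fieldType) (V : vectType K) (u : 'rV[K]_3 -> V).
Hypothesis lin_u : forall a z z', u (a *: z + z') = a *: u z + u z'.
Hypothesis inj_u : forall z, u z = 0 -> z = 0.

Definition span3 : {vspace V} :=
  <<[:: u (vec3 1 0 0); u (vec3 0 1 0); u (vec3 0 0 1)]>>%VS.

Lemma lin3_0 : u 0 = 0.
Proof.
have := lin_u 1 0 0; rewrite scaler0 add0r scale1r => /esym/eqP.
by rewrite -subr_eq0 addrK => /eqP.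
Qed.
Lemma lin3Z a z : u (a *: z) = a *: u z.
Proof. by rewrite -[_ *: z]addr0 lin_u lin3_0 addr0. Qed.
Lemma lin3D z z' : u (z + z') = u z + u z'.
Proof. by rewrite -{1}(scale1r z) lin_u scale1r. Qed.

Lemma lin3E x y z : u (vec3 x y z) =
  x *: u (vec3 1 0 0) + (y *: u (vec3 0 1 0) + z *: u (vec3 0 0 1)).
Proof.
rewrite -!lin3Z -!lin3D !vec3Z !vec3D; congr (u (vec3 _ _ _));
by rewrite !mulr0 !mulr1 ?addr0 ?add0r.
Qed.

Lemma lin3_inj : injective u.
Proof.
move=> z z' e; apply/eqP; rewrite -subr_eq0; apply/eqP; apply: inj_u.
by rewrite lin3D -scaleN1r lin3Z e scaleN1r subrr.
Qed.

Lemma span3P w : reflect (exists z, w = u z) (w \in span3).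
Proof.
rewrite /span3 !span_cons span_nil addv0; apply: (iffP memv_addP).
  move=> [_ /vlineP[x ->] [_ /memv_addP[_ /vlineP[y ->] [_ /vlineP[z ->] ->]] ->]].
  by exists (vec3 x y z); rewrite -lin3E.
move=> [z ->]; have := lin3E (z 0 o0) (z 0 o1) (z 0 o2); rewrite -vec3_eta => ->.
exists (z 0 o0 *: u (vec3 1 0 0)); first by rewrite memvZ ?memv_line.
exists (z 0 o1 *: u (vec3 0 1 0) + z 0 o2 *: u (vec3 0 0 1)) => //.
by rewrite memv_add // memvZ // memv_line.
Qed.

Lemma dim_span3 : \dim span3 = 3%N.
Proof.
apply/eqP/(freeP (X := [tuple u (vec3 1 0 0); u (vec3 0 1 0); u (vec3 0 0 1)])).
move=> k; rewrite !big_ord_recl big_ord0 addr0 /= -lin3E => /inj_u.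
rewrite -vec3_0 => /vec3_inj[k0 k1 k2] [[|[|[|//]]] lti];
  [rewrite -[RHS]k0|rewrite -[RHS]k1|rewrite -[RHS]k2]; congr k; exact: val_inj.
Qed.
End Span3.

(* [fr_im] puts [eps] and [alp] in the image of [th - la], so that the planes
   below lie in the hwise-fixed 5-space that is the image of [s - la]. *)
Record frame (F : finFieldType) (L : fieldExtType F) (th : L -> L)
  (dl : bool) (mu nu : F) (eps alp : L) : Prop := Frame {
  fr_free : forall x y : F, x%:A * eps + y%:A * alp = 0 -> x = 0 /\ y = 0;
  fr_eps : th eps = mu%:A * eps;
  fr_alp : th alp = nu%:A * alp + dl%:R * eps;
  fr_dl : (mu == nu) = dl;
  fr_im : exists la c y1 y2, [/\ c != 0, th c = la%:A * c,
     th y1 - la%:A * y1 = eps & th y2 - la%:A * y2 = alp] }.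

(** The coordinates z are arranged so that [s] acts by the same map [act] in the three normal forms
    and the ptwise-fixed line is always [z 0 o2 = 0]. *)
Definition plane_row (F : finFieldType) (L : fieldExtType F) (h1 dl : bool)
    (eps alp : L) (z : 'rV[F]_3) : 'rV[L]_3 :=
  let z1 := in_alg L (z 0 o0) in
  let z2 := in_alg L (z 0 o1) in
  let z3 := in_alg L (z 0 o2) in
  if h1 then vec3 (z1 * eps + z3 * alp) (z2 * eps) 0
  else if dl then vec3 (z1 * eps + z3 * alp) (z2 * eps) (z3 * eps)
  else vec3 (z1 * eps) (z2 * eps) (z3 * alp).

Definition plane_map (F : finFieldType) (L : fieldExtType F)
    (kappa : 'rV[L]_3 -> 'rV[F]_9) (h1 dl : bool) (eps alp : L) z :=
  kappa (plane_row h1 dl eps alp z).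

Definition hplane (F : finFieldType) (L : fieldExtType F)
    (kappa : 'rV[L]_3 -> 'rV[F]_9) (h1 dl : bool) (eps alp : L) :=
  span3 (plane_map kappa h1 dl eps alp).

(* The coordinates of the vectors of a plane whose point is not fixed by s. *)
Definition moving (F : finFieldType) (dl : bool) (z : 'rV[F]_3) :=
  (z 0 o2 != 0) && [|| dl, z 0 o0 != 0 | z 0 o1 != 0].

(** * Numbers of moving and of fixed vectors *)

Section CountMoving.
Variables (F : finFieldType) (dl : bool).
Local Notation q := #|F|.
(** As [dl] marks the case q = 0 mod 3, this is the n of the theorem when q is 0 or 1 mod 3. *)
Local Notation n := (~~ dl : nat).
Let q1 : (1 < q)%N := finNzRing_gt1 F.

Lemma card_moving : #|[set z : 'rV[F]_3 | moving dl z]| = ((q ^ 2 - n) * (q - 1))%N.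
Proof.
rewrite (card_row3 (fun x y z => (z != 0) && [|| dl, x != 0 | y != 0])).
have -> : [set z : F * F * F | (z.2 != 0) && [|| dl, z.1.1 != 0 | z.1.2 != 0]]
   = setX (if dl then [set: F * F] else [set~ (0, 0)]) [set~ 0].
  apply/setP => -[[x y] z]; rewrite !inE /= andbC; case: dl; rewrite !inE //=.
  by rewrite xpair_eqE negb_and.
rewrite cardsX cardsC1; case: dl; rewrite ?cardsT ?cardsC1 card_prod /=;
by move: #|F| q1 => r r1; nia.
Qed.

Lemma card_moving0 : #|[set z : 'rV[F]_3 | moving dl z & z 0 o1 == 0]|
  = ((q - n) * (q - 1))%N.
Proof.
rewrite (card_row3 (fun x y z => ((z != 0) && [|| dl, x != 0 | y != 0]) && (y == 0))).
have -> : [set z : F * F * F | (z.2 != 0) && [|| dl, z.1.1 != 0 | z.1.2 != 0] & z.1.2 == 0]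
   = setX (setX (if dl then [set: F] else [set~ 0]) [set 0]) [set~ 0].
  apply/setP => -[[x y] z]; rewrite !inE /=; case: (y == 0); case: (z == 0);
  by case: dl; rewrite !inE ?andbF //= ?orbF ?andbT.
rewrite !cardsX cardsC1 cards1; case: dl; rewrite ?cardsT ?cardsC1 /=;
by move: #|F| q1 => r r1; nia.
Qed.

Lemma card_moving_nz : #|[set z : 'rV[F]_3 | moving dl z & z 0 o1 != 0]|
  = ((q ^ 2 - q) * (q - 1))%N.
Proof.
have := cardsID [set z : 'rV[F]_3 | z 0 o1 == 0] [set z : 'rV[F]_3 | moving dl z].
rewrite card_moving.
have -> : [set z : 'rV[F]_3 | moving dl z] :&: [set z : 'rV[F]_3 | z 0 o1 == 0] =
   [set z : 'rV[F]_3 | moving dl z & z 0 o1 == 0] by apply/setP => z; rewrite !inE.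
have -> : [set z : 'rV[F]_3 | moving dl z] :\: [set z : 'rV[F]_3 | z 0 o1 == 0] =
   [set z : 'rV[F]_3 | moving dl z & z 0 o1 != 0] by apply/setP => z; rewrite !inE andbC.
rewrite card_moving0; move: #|F| q1 => r r1; case: dl => /=; nia.
Qed.

Lemma card_still : #|[set z : 'rV[F]_3 | (z != 0) && ~~ moving dl z]|
  = ((q + 1 + n) * (q - 1))%N.
Proof.
have := cardsC [set z : 'rV[F]_3 | moving dl z]; rewrite card_moving card_mx mul1n.
have -> : ~: [set z : 'rV[F]_3 | moving dl z] =
  0 |: [set z : 'rV[F]_3 | (z != 0) && ~~ moving dl z].
  apply/setP => z; rewrite !inE; case: eqVneq => //= ->.
  by rewrite /moving !mxE eqxx.
rewrite cardsU1 inE eqxx /= ; move: #|F| q1 => r r1; case: dl => /=; nia.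
Qed.
End CountMoving.

(** * Points and lines inside one standard plane *)

Section InPlane.
Variables (F : finFieldType) (L : fieldExtType F)
  (P2q : {vspace 'rV[L]_3} -> Prop) (phi : {vspace 'rV[L]_3} -> {vspace 'rV[L]_3})
  (beta : 'rV[L]_3 -> 'rV[F]_9) (s : 'End('rV[F]_9)) (th : {lrmorphism L -> L})
  (kappa : 'rV[L]_3 -> 'rV[F]_9).
Hypotheses (ad : adapted P2q phi beta s th kappa) (s3 : forall w, s (s (s w)) = w).
Variables (h1 dl : bool) (mu nu : F) (eps alp : L).
Hypothesis fr : frame th dl mu nu eps alp.

Local Notation pr := (plane_row h1 dl eps alp).
Local Notation u := (plane_map kappa h1 dl eps alp).
Local Notation U := (hplane kappa h1 dl eps alp).
Local Notation ia := (in_alg L).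

Let idK := ad_ident ad.

Lemma plane_row_lin a z z' : pr (a *: z + z') = a%:A *: pr z + pr z'.
Proof.
rewrite /plane_row -[a%:A]/(ia a) !mxE !rmorphD !rmorphM.
case: h1; [|case: dl]; rewrite vec3Z vec3D; congr vec3; ring.
Qed.

Lemma plane_row_inj z : pr z = 0 -> z = 0.
Proof.
have fr0 x y : ia x * eps + ia y * alp = 0 -> x = 0 /\ y = 0 by apply: (fr_free fr).
have fre x : ia x * eps = 0 -> x = 0.
  by move=> e; case: (fr0 x 0); rewrite ?rmorph0 ?mul0r ?addr0.
have fra x : ia x * alp = 0 -> x = 0.
  by move=> e; case: (fr0 0 x); rewrite ?rmorph0 ?mul0r ?add0r.
move=> e; rewrite (vec3_eta z) -vec3_0; move: e; rewrite /plane_row -vec3_0.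
case: h1; [|case: dl] => /vec3_inj[e1 e2 e3]; congr vec3; eauto.
- by case: (fr0 _ _ e1).
- by case: (fr0 _ _ e1).
- by case: (fr0 _ _ e1).
Qed.

Lemma plane_map_lin a z z' : u (a *: z + z') = a *: u z + u z'.
Proof. by rewrite /plane_map plane_row_lin idK.2. Qed.

Lemma plane_map_inj0 z : u z = 0 -> z = 0.
Proof. by move/eqP; rewrite (ident_eq0 idK) => /eqP/plane_row_inj. Qed.

Lemma plane_map_eq0 z : (u z == 0) = (z == 0).
Proof.
apply/eqP/eqP => [/plane_map_inj0//|->]; exact: (lin3_0 plane_map_lin).
Qed.

Lemma plane_map_inj : injective u. Proof. exact: (lin3_inj plane_map_lin plane_map_inj0). Qed.

Lemma hplaneP w : reflect (exists z, w = u z) (w \in U).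
Proof. exact: (span3P plane_map_lin). Qed.

Definition act (z : 'rV[F]_3) : 'rV[F]_3 :=
  vec3 (mu * z 0 o0 + dl%:R * z 0 o2) (mu * z 0 o1) (nu * z 0 o2).

Lemma th_plane_row z : map_mx th (pr z) = pr (act z).
Proof.
have tha x : th (ia x) = ia x by exact: th_alg.
have the : th eps = ia mu * eps := fr_eps fr.
have := fr_alp fr; rewrite -[nu%:A]/(ia nu) => thal.
(* If [dl] holds, the third entry of an h2-row is a multiple of [eps], which [th] scales by [mu],
   while [act] has [nu] there; [fr_dl] makes them equal. *)
have := fr_dl fr; move: thal; rewrite /plane_row /act !vec3E.
case: h1; case: dl; rewrite /= ?mulr1n ?mulr0n => thal e; rewrite map_vec3 ?rmorphD ?rmorphM /= ?tha ?rmorph0 ?the ?thal;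
  move/eqP: e => e; congr vec3;
  rewrite -?in_algE ?rmorphD ?rmorphM ?rmorph0 ?rmorph1 ?e; ring.
Qed.

Lemma s_plane_map z : s (u z) = u (act z).
Proof. by rewrite /plane_map (ad_s ad) th_plane_row. Qed.

Lemma act_quadr z : act (act z) = (mu + nu) *: act z - (mu * nu) *: z.
Proof.
rewrite (vec3_eta z) /act !vec3E -scaleN1r !vec3Z !vec3D; congr vec3; ring.
Qed.

(** If [dl] fails, [act] is diagonal with entries mu, mu, nu and mu <> nu. If it holds, [act] has a
    single eigenvalue, with eigenspace [z 0 o2 = 0]. *)
Lemma movingP z : ~~ moving dl z <-> exists k, act z = k *: z.
Proof.
have dlE := fr_dl fr; rewrite /moving /act; split.
  rewrite negb_and !negb_or !negbK => /orP[/eqP z2|/and3P[ndl /eqP z0 /eqP z1]].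
    exists mu; rewrite [z in RHS]vec3_eta vec3Z z2 !mulr0 addr0 //.
  exists nu; rewrite [z in RHS]vec3_eta vec3Z z0 z1 (negPf ndl) !mulr0 mul0r addr0 //.
move=> [k]; rewrite [z in RHS]vec3_eta vec3Z => /vec3_inj[e0 e1 e2].
apply/andP => -[z2 /or3P H].
have nuk : nu = k by apply: (mulIf z2).
have muk x : mu * x = k * x -> x != 0 -> dl.
  by move=> e x0; rewrite -dlE nuk; apply/eqP/(mulIf x0).
have d : dl.
  case: H => //; last exact: muk.
  have [//|ndl] := boolP dl; move: e0; rewrite (negPf ndl) mul0r addr0.
  by move=> e /(muk _ e); rewrite (negPf ndl).
move: e0 dlE; rewrite d mul1r nuk => e /eqP muk'; move: e; rewrite muk' => /eqP.
by rewrite -subr_eq0 addrAC subrr add0r (negPf z2).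
Qed.

Lemma plane_map_line_mem z z' : u z' \in <[u z]>%VS <-> exists k, z' = k *: z.
Proof.
split=> [/vlineP[k]|[k ->]]; last by rewrite (lin3Z plane_map_lin) memvZ ?memv_line.
by rewrite -(lin3Z plane_map_lin) => /plane_map_inj ->; exists k.
Qed.

Lemma moving_nz (z : 'rV[F]_3) : moving dl z -> z != 0.
Proof. by apply: contraTneq => ->; rewrite /moving !mxE eqxx. Qed.

Lemma s_moving z : (s (u z) \notin <[u z]>%VS) = moving dl z.
Proof.
rewrite s_plane_map; apply/idP/idP => [|mz].
  by apply: contraR => /movingP ?; apply/plane_map_line_mem.
by apply/negP => /plane_map_line_mem /movingP; rewrite mz.
Qed.

Lemma s_neq0 w : w != 0 -> s w != 0.
Proof. by apply: contraNneq => e; rewrite -(s3 w) e !linear0. Qed.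

Lemma fixed_line w : w != 0 -> fixed s <[w]>%VS <-> s w \in <[w]>%VS.
Proof.
move=> w0; rewrite /fixed limg_line; split=> [<-|/line_eqP]; first exact: memv_line.
by apply; exact: s_neq0.
Qed.

Lemma fixed_plane_map z : z != 0 -> fixed_point s <[u z]>%VS <-> ~~ moving dl z.
Proof.
move=> z0; have uz0 : u z != 0 by rewrite plane_map_eq0.
rewrite /fixed_point is_point_line fixed_line // -s_moving negbK.
by split=> [[]|].
Qed.

Lemma dim_moving_line z : moving dl z -> \dim (<[u z]> + <[s (u z)]>) = 2%N.
Proof.
move=> mz; apply: dim_add_lines; last by rewrite s_moving.
by rewrite plane_map_eq0 moving_nz.
Qed.

Lemma s2_moving_line z : s (s (u z)) \in (<[u z]> + <[s (u z)]>)%VS.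
Proof.
rewrite !s_plane_map act_quadr addrC -scaleNr plane_map_lin (lin3Z plane_map_lin).
by apply: memv_add; rewrite memvZ ?memv_line.
Qed.

Lemma collinear_moving z : moving dl z ->
  collinear <[u z]>%VS (s @: <[u z]>)%VS (s @: (s @: <[u z]>))%VS.
Proof.
move=> mz; exists (<[u z]> + <[s (u z)]>)%VS; split; first exact: dim_moving_line.
by rewrite !limg_line addvSl addvSr -memvE s2_moving_line.
Qed.

Lemma distinct_moving z : moving dl z ->
  distinct3 <[u z]>%VS (s @: <[u z]>)%VS (s @: (s @: <[u z]>))%VS.
Proof.
move=> mz; rewrite !limg_line; have := s_moving z; rewrite mz => nm.
split=> e; case/negP: nm.
- by rewrite e memv_line.
- have /vlineP[k] : s (s (u z)) \in <[s (u z)]>%VS by rewrite e memv_line.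
  move/(congr1 s)/(congr1 s); rewrite !linearZ /= !s3 => ->.
  by rewrite memvZ ?memv_line.
- have /vlineP[k] : u z \in <[s (s (u z))]>%VS by rewrite -e memv_line.
  by move/(congr1 s); rewrite linearZ /= s3 => ->; rewrite memvZ ?memv_line.
Qed.

(** In each case the row is an element of L times a vector over F. The element is [eps] if
    [z 0 o2 = 0], and [alp] for the remaining vectors that are not moving; in type h1 with
    [z 0 o1 = 0] the row is a multiple of e1. *)
Lemma plane_map_I_point z : z != 0 -> ~~ moving dl z \/ h1 && (z 0 o1 == 0) ->
  I_point P2q beta <[u z]>%VS.
Proof.
move=> z0 H; apply/(ad_I ad); split.
  by apply: contra z0 => /eqP/plane_row_inj ->.
have [z2|z2] := eqVneq (z 0 o2) 0.
  exists eps, (vec3 (z 0 o0) (z 0 o1) 0).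
  rewrite /plane_row z2 rmorph0 map_vec3 vec3Z !mul0r.
  by case: h1; [|case: dl]; rewrite ?rmorph0 ?mulr0 ?addr0; congr vec3; ring.
case: H => [|/andP[h1t /eqP z1]].
  rewrite /moving z2 /= !negb_or !negbK => /and3P[ndl /eqP e0 /eqP e1].
  exists alp; rewrite /plane_row e0 e1 (negPf ndl) rmorph0 !mul0r add0r.
  by case: h1; [exists (vec3 (z 0 o2) 0 0) | exists (vec3 0 0 (z 0 o2))];
    rewrite map_vec3 vec3Z !rmorph0; congr vec3; ring.
exists (ia (z 0 o0) * eps + ia (z 0 o2) * alp), (vec3 1 0 0).
by rewrite /plane_row h1t map_vec3 vec3Z z1 !rmorph0 rmorph1; congr vec3; ring.
Qed.

(** [act_quadr] gives the dependence of v, v^th and v^(th^2). Outside the excluded case some nonzero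
    entry of v is an F-multiple of [eps], so v^th = c v would put c in F and make z an eigenvector
    of [act]. *)
Lemma plane_map_II_point z : moving dl z -> ~~ (h1 && (z 0 o1 == 0)) ->
  II_point phi beta <[u z]>%VS.
Proof.
move=> mz nh; pose k := ia (- (mu * nu)); pose l := ia (mu + nu).
apply: (ad_II ad (k := k) (l := l)); last first.
  rewrite !th_plane_row act_quadr addrC -scaleNr plane_row_lin.
  rewrite -[(mu + nu) *: act z]addr0 plane_row_lin.
  by rewrite (_ : pr 0 = 0) ?addr0 //; apply/eqP; rewrite -(ident_eq0 idK) plane_map_eq0.
move=> c; rewrite th_plane_row => e.
have [k' kc] : exists k', ia k' = c.
  have ee : eps != 0.
    apply/eqP => e0; have := @fr_free _ _ _ _ _ _ _ _ fr 1 0.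
    by rewrite e0 mulr0 scale0r mul0r addr0 => /(_ erefl)[/eqP]; rewrite oner_eq0.
  have ea : alp != 0.
    apply/eqP => e0; have := @fr_free _ _ _ _ _ _ _ _ fr 0 1.
    by rewrite e0 mulr0 scale0r mul0r addr0 => /(_ erefl)[_ /eqP]; rewrite oner_eq0.
  have gen x y g : g != 0 -> y != 0 -> ia x * g = c * (ia y * g) -> exists k', ia k' = c.
    move=> g0 y0; rewrite mulrA => /(mulIf g0) e'; exists (x / y).
    transitivity (ia x / ia y); first exact: fmorph_div.
    by rewrite e' mulfK // fmorph_eq0.
  move: e nh mz; rewrite /plane_row /moving; case: h1.
    rewrite vec3Z => /vec3_inj[_ e _] /= z1 _; exact: gen e.
  case: dl; rewrite vec3Z => /vec3_inj[e0 e1 e2] _ /andP[z2] /=.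
    by move=> _; exact: gen e2.
  by case/orP=> zz; [exact: gen e0|exact: gen e1].
move: mz; apply/negP/movingP; exists k'.
apply: plane_map_inj; rewrite /plane_map e -kc; congr (kappa _).
rewrite -[k' *: z]addr0 plane_row_lin.
by rewrite (_ : pr 0 = 0) ?addr0 //; apply/eqP; rewrite -(ident_eq0 idK) plane_map_eq0.
Qed.

(** The conditions of [plane_map_I_point] and [plane_map_II_point] are complementary and no point is
    both a I-point and a II-point, so both conditions are also necessary. The next lemma uses the
    same argument. *)
Lemma plane_map_Idots z : z != 0 ->
  Idots_point P2q beta s <[u z]>%VS <-> moving dl z && (h1 && (z 0 o1 == 0)).
Proof.
move=> z0; split=> [[Iz [ne _ _] _]|/andP[mz h]].
  have mz : moving dl z.
    apply/negPn/negP => /(fixed_plane_map z0)[_]; rewrite /fixed => e; exact: ne.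
  by rewrite mz /=; apply/negPn/negP => nh; apply: (ad_notI ad (plane_map_II_point mz nh)).
by split; [apply: plane_map_I_point => //; right|exact: distinct_moving|exact: collinear_moving].
Qed.

Lemma plane_map_IIdots z : z != 0 ->
  IIdots_point phi beta s <[u z]>%VS <-> moving dl z && ~~ (h1 && (z 0 o1 == 0)).
Proof.
move=> z0; split=> [[IIz _]|/andP[mz nh]]; last by split; [exact: plane_map_II_point|exact: collinear_moving].
apply/negPn/negP; rewrite negb_and negbK => /orP H.
by apply: (ad_notI ad IIz); apply: plane_map_I_point.
Qed.

Lemma hplane_points A : is_point A -> (A <= U)%VS -> exists2 z, z != 0 & A = <[u z]>%VS.
Proof.
case/is_pointP => w w0 ->; rewrite -memvE => /hplaneP[z e].
by exists z; rewrite ?e // -plane_map_eq0 -e.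
Qed.

Lemma contains_points (Q : {vspace 'rV[F]_9} -> Prop) (R : pred 'rV[F]_3) N :
    (forall A, Q A -> is_point A) ->
    (forall z, z != 0 -> Q <[u z]>%VS <-> R z) ->
    #|[set z | (z != 0) && R z]| = (N * (#|F| - 1))%N ->
  contains_exactly U Q N%:Z.
Proof.
move=> Qpt QR; have lineZ k z : k != 0 -> <[u (k *: z)]>%VS = <[u z]>%VS.
  move=> k0; rewrite (lin3Z plane_map_lin); have [->|uz0] := eqVneq (u z) 0.
    by rewrite scaler0.
  by apply/line_eqP; rewrite ?scaler_eq0 ?negb_or ?k0 // memvZ ?memv_line.
apply: (has_card_points (f := fun z => <[u z]>%VS)).
- by rewrite inE eqxx.
- move=> k z k0; rewrite !inE scaler_eq0 negb_or k0 /= => /andP[z0 /(QR _ z0) Qz].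
  rewrite z0 /=; apply/QR; first by rewrite scaler_eq0 negb_or k0.
  by rewrite lineZ.
- exact: lineZ.
- move=> v w _ _ e; apply/plane_map_line_mem.
  by rewrite -[<[_]>%VS]e memv_line.
- move=> A; split.
    move=> [QA /(hplane_points (Qpt _ QA))[z z0 e]]; exists z => //.
    by rewrite inE z0; apply/QR; rewrite // -e.
  move=> [z]; rewrite inE => /andP[z0 Rz] <-; split; first exact/QR.
  by rewrite -memvE; apply/hplaneP; exists z.
Qed.

Local Notation line z := (<[plane_map kappa h1 dl eps alp z]>
   + <[s (plane_map kappa h1 dl eps alp z)]>)%VS.

Lemma line_fixed z : (s @: line z)%VS = line z.
Proof.
apply/eqP; rewrite eqEdim limg_dim_eq; last first.
  apply/eqP; rewrite -subv0; apply/subvP => w; rewrite memv_cap memv_ker => /andP[_ /eqP e].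
  by rewrite -(s3 w) e !linear0 mem0v.
rewrite leqnn andbT limgD !limg_line subv_add addvSr /= -memvE; exact: s2_moving_line.
Qed.

Lemma line_mem z z' : reflect (exists a b, z' = a *: z + b *: act z) (u z' \in line z).
Proof.
apply: (iffP memv_addP).
  move=> [_ /vlineP[a ->] [_ /vlineP[b ->]]].
  rewrite s_plane_map -(lin3Z plane_map_lin b) -plane_map_lin => /plane_map_inj ->; by exists a, b.
move=> [a [b ->]]; exists (a *: u z); first by rewrite memvZ ?memv_line.
exists (b *: s (u z)); first by rewrite memvZ ?memv_line.
by rewrite plane_map_lin (lin3Z plane_map_lin) s_plane_map.
Qed.

Lemma fixed_line_moving l z : is_line l -> fixed s l -> moving dl z ->
  (<[u z]> <= l)%VS -> l = line z.
Proof.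
move=> dl2 fl mz zl; apply/esym/eqP; rewrite eqEdim dim_moving_line // dl2 subv_add zl leqnn andbT /=.
by rewrite -fl -limg_line limgS.
Qed.

(** A fixed line through a moving point is spanned by that point and its image, so lines are counted
    by the moving vectors on them, [(q - n) * (q - 1)] on each. The entry [z 0 o1] vanishes at all
    or at none of these, so p can select the I-points, the II-points or both. *)
Lemma contains_lines (Q Ql : {vspace 'rV[F]_9} -> Prop) (p : pred bool) N :
    (forall l, Ql l <-> [/\ is_line l, fixed s l & exists2 A, Q A & (A <= l)%VS]) ->
    (forall A, Q A -> is_point A) ->
    (forall z, z != 0 -> Q <[u z]>%VS <-> moving dl z && p (z 0 o1 == 0)) ->
    #|[set z : 'rV[F]_3 | moving dl z && p (z 0 o1 == 0)]|
      = (N * ((#|F| - (~~ dl : nat)) * (#|F| - 1)))%N ->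
  contains_exactly U Ql N%:Z.
Proof.
move=> QlE Qpt QR; apply: (has_card_fiber (f := fun z => line z)).
- have q1 := finNzRing_gt1 F.
  by rewrite muln_gt0 !subn_gt0 q1 andbT; case: dl => //=; apply: ltnW.
- move=> l; split.
    move=> [/QlE[l2 fl [A QA Al]] lU].
    have [z z0 e] := hplane_points (Qpt _ QA) (subv_trans Al lU).
    have := QA; rewrite e => /(QR _ z0) Rz.
    exists z; first by rewrite inE.
    apply/esym; apply: fixed_line_moving => //; last by rewrite -e.
    by case/andP: Rz.
  move=> [z]; rewrite inE => Rz <-; have [mz pz] := andP Rz; split.
    apply/QlE; split; [exact: dim_moving_line|exact: line_fixed|].
    exists <[u z]>%VS; last exact: addvSl.
    by apply/QR => //; exact: moving_nz.
  by rewrite subv_add -!memvE s_plane_map; apply/andP; split; apply/hplaneP; eexists.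
move=> z; rewrite inE => /andP[mz pz].
(* [g] parametrizes the moving vectors on [line z]. If mu <> nu, the first two entries and the third
   one are scaled independently; if [dl] holds, a multiple of z is shifted along (1, 0, 0). *)
pose g (xy : F * F) := if dl then vec3 (xy.1 * z 0 o0 + xy.2) (xy.1 * z 0 o1) (xy.1 * z 0 o2)
  else vec3 (xy.1 * z 0 o0) (xy.1 * z 0 o1) (xy.2 * z 0 o2).
have cD : #|[set xy : F * F | (xy.1 != 0) && (dl || (xy.2 != 0))]| =
  ((#|F| - (~~ dl : nat)) * (#|F| - 1))%N.
  have -> : [set xy : F * F | (xy.1 != 0) && (dl || (xy.2 != 0))] =
      setX [set~ 0] (if dl then [set: F] else [set~ 0]).
    by apply/setP => -[x y]; rewrite !inE /=; case: dl; rewrite !inE.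
  by rewrite cardsX mulnC cardsC1; case: dl; rewrite ?cardsT ?cardsC1 /= ?subn0 ?subn1.
have [z2 mz'] := andP mz.
have dlE := fr_dl fr.
rewrite -cD -(card_in_imset (f := g)); last first.
  move=> [x y] [x' y'] _ _; rewrite /g; case: dl mz' => /= mz'.
    by move=> /vec3_inj[+ _ /(mulIf z2) e]; rewrite e => /addrI ->.
  move=> /vec3_inj[e0 e1 /(mulIf z2) ->].
  by case/orP: mz' => nz; congr pair; [exact: mulIf e0|exact: mulIf e1].
apply: eq_card => z'; rewrite !inE; apply/andP/imsetP.
  move=> [/andP[mw pw] /eqP e].
  have /line_mem[a [b ew]] : u z' \in line z by rewrite -e memvE addvSl.
  have {}ew : z' = vec3 ((a + b * mu) * z 0 o0 + b * dl%:R * z 0 o2) ((a + b * mu) * z 0 o1)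
      ((a + b * nu) * z 0 o2).
    rewrite ew {1}(vec3_eta z) /act !vec3Z vec3D; congr vec3; ring.
  move: mw; rewrite /moving ew !vec3E /g; move: dlE; case: dl => [/eqP mn|mn] /=.
    rewrite mulf_eq0 negb_or => /andP[/andP[an _] _].
    exists (a + b * mu, b * z 0 o2); first by rewrite inE /= mn an.
    by congr vec3; rewrite /= ?mn; ring.
  rewrite mulr0 mul0r addr0 !mulf_eq0 !negb_or => /andP[/andP[an _] am].
  exists (a + b * mu, a + b * nu) => //; rewrite inE /= an andbT.
  by case/orP: am => /andP[].
move=> [[x y]]; rewrite inE /= => /andP[x0 y0] e.
have mz1 : moving dl z'.
  rewrite e /moving /g; case: dl y0 mz' => /= y0 mz'; rewrite !vec3E !mulf_eq0 !negb_or.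
    by rewrite x0 z2.
  by rewrite y0 z2 x0.
have pz1 : p (z' 0 o1 == 0).
  suff -> : (z' 0 o1 == 0) = (z 0 o1 == 0) by [].
  by rewrite e /g; case: dl; rewrite !vec3E mulf_eq0 (negPf x0).
rewrite mz1 pz1; split=> //.
have zl : u z' \in line z.
  (* The coefficients a, b solve [a + b * mu = x], together with [b * z 0 o2 = y] if [dl] holds and
     [a + b * nu = y] otherwise. *)
  apply/line_mem; rewrite e /g /act; move: dlE; case: dl => /= [/eqP mn|/negbT mn].
    exists (x - y / z 0 o2 * mu), (y / z 0 o2).
    rewrite [X in _ *: X + _](vec3_eta z) !vec3Z vec3D mn mul1r; congr vec3; try ring.
    rewrite mulrDr divfK //; ring.
  have mn0 : mu - nu != 0 by rewrite subr_eq0.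
  exists (x - (x - y) / (mu - nu) * mu), ((x - y) / (mu - nu)).
  rewrite [X in _ *: X + _](vec3_eta z) !vec3Z vec3D mul0r addr0; congr vec3; try ring.
  transitivity ((x - (x - y) / (mu - nu) * (mu - nu)) * z 0 o2); last ring.
  rewrite divfK //; ring.
apply/eqP/eqP; rewrite eqEdim !dim_moving_line // leqnn andbT subv_add -memvE zl /=.
by rewrite -line_fixed -limg_line limgS // -memvE.
Qed.

(** A pointwise fixed line not inside [z 0 o2 = 0] would contain a fixed point off that line, which
    must be (0, 0, 1), with [dl] false. Any other vector of the line and its sum with this one are
    fixed too, which makes it a multiple of (0, 0, 1). *)
Lemma contains_ptwise_line : contains_exactly U (ptwise_fixed_line s) 1.
Proof.
pose l := (<[u (vec3 1 0 0)]> + <[u (vec3 0 1 0)]>)%VS.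
have lP w : reflect (exists x y, w = u (vec3 x y 0)) (w \in l).
  have uE x y : u (vec3 x y 0) = x *: u (vec3 1 0 0) + y *: u (vec3 0 1 0).
    by rewrite (lin3E plane_map_lin) scale0r addr0.
  apply: (iffP memv_addP).
    by move=> [_ /vlineP[x ->] [_ /vlineP[y ->] ->]]; exists x, y; rewrite -uE.
  move=> [x [y ->]]; exists (x *: u (vec3 1 0 0)); first by rewrite memvZ ?memv_line.
  by exists (y *: u (vec3 0 1 0)); [rewrite memvZ ?memv_line|rewrite -uE].
have vnz x y : (x != 0) || (y != 0) -> vec3 x y 0 != 0 :> 'rV[F]_3.
  by move=> nz; apply/eqP; rewrite -vec3_0 => /vec3_inj[x0 y0 _]; move: nz; rewrite x0 y0 eqxx.
have l2 : \dim l = 2%N.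
  apply: dim_add_lines; first by rewrite plane_map_eq0 vnz ?oner_neq0.
  apply/negP => /plane_map_line_mem[k]; rewrite vec3Z mulr0 => /vec3_inj[_ /eqP].
  by rewrite oner_eq0.
exists [:: l]; split=> // l'; rewrite inE; split.
  move/eqP => ->; split; last first.
    by rewrite subv_add -!memvE; apply/andP; split; apply/hplaneP; eexists.
  split=> // A /is_pointP[w w0 ->]; rewrite -memvE => /lP[x [y e]].
  have z0 : vec3 x y 0 != 0 :> 'rV[F]_3 by rewrite -plane_map_eq0 -e.
  by rewrite e; apply: (proj2 (fixed_plane_map z0) _).2; rewrite /moving vec3E eqxx.
move=> [[l'2 ptw] l'U]; rewrite eqEdim l'2 l2 leqnn andbT.
have still z : u z \in l' -> ~~ moving dl z.
  move=> zl; have [->|z0] := eqVneq z 0; first by rewrite /moving !mxE eqxx.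
  apply/(fixed_plane_map z0); have pz : is_point <[u z]>%VS by apply/is_point_line; rewrite plane_map_eq0.
  by split=> //; apply: ptw; rewrite -?memvE.
apply/subvP => w wl'; have /hplaneP[z e] := subvP l'U _ wl'; apply/lP.
suff z2 : z 0 o2 = 0 by exists (z 0 o0), (z 0 o1); rewrite e [z in LHS]vec3_eta z2.
apply/eqP/negPn/negP => z2.
have := still z; rewrite -e wl' /moving z2 /= !negb_or !negbK => /(_ isT) /and3P[ndl /eqP z0 /eqP z1].
have : ~~ (l' <= <[u z]>)%VS.
  by apply/negP => /dimvS; rewrite l'2 dim_vline; case: (_ != 0).
case/subvPn => w' w'l /negP; have /hplaneP[z' e'] := subvP l'U _ w'l; case.
rewrite e'; apply/plane_map_line_mem; exists (z' 0 o2 / z 0 o2).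
have [z'0 z'1] : z' 0 o0 = 0 /\ z' 0 o1 = 0.
  have := still z'; have := still (z + z'); rewrite (lin3D plane_map_lin) -e -e' w'l memvD // => /(_ isT).
  rewrite /moving !mxE z0 z1 !add0r (negPf ndl) /= => m1 /(_ isT) m2.
  have [z'2|z'2] := eqVneq (z' 0 o2) 0.
    move: m1; rewrite z'2 addr0 z2 /= negb_or !negbK => /andP[/eqP -> /eqP ->] //.
  move: m2; rewrite z'2 /= negb_or !negbK => /andP[/eqP -> /eqP ->] //.
by apply: row3P; rewrite [RHS]mxE ?z0 ?z1 ?z'0 ?z'1 ?mulr0 ?divfK.
Qed.

End InPlane.

(** * Hwise-fixed 5-spaces and the statistics of a plane *)

Lemma dim_full9 (F : fieldType) : \dim {:'rV[F]_9} = 9%N.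
Proof. by rewrite dimvf. Qed.

Section Hwise.
Variables (F : finFieldType) (L : fieldExtType F)
  (P2q : {vspace 'rV[L]_3} -> Prop) (phi : {vspace 'rV[L]_3} -> {vspace 'rV[L]_3})
  (beta : 'rV[L]_3 -> 'rV[F]_9) (s : 'End('rV[F]_9)) (th : {lrmorphism L -> L})
  (kappa : 'rV[L]_3 -> 'rV[F]_9).
Hypothesis hL : \dim {:L}%VS = 3%N.
Hypothesis th_nt : exists x, th x != x.
Hypotheses (ad : adapted P2q phi beta s th kappa) (s3 : forall w, s (s (s w)) = w).

Let idK := ad_ident ad.

Definition shift (la : F) : 'End('rV[F]_9) := s - la *: \1%VF.

Lemma shiftE la w : shift la w = s w - la *: w.
Proof. by rewrite /shift add_lfunE opp_lfunE scale_lfunE id_lfunE. Qed.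

Lemma s_lker0 : lker s == 0%VS.
Proof.
apply/lker0P => w w' e; by rewrite -(s3 w) e s3.
Qed.

Lemma fixed_stable (U : {vspace 'rV[F]_9}) :
  (forall w, w \in U -> s w \in U) -> fixed s U.
Proof.
move=> sU; apply/eqP; rewrite eqEdim limg_dim_eq; last by rewrite (eqP s_lker0) capv0.
by rewrite leqnn andbT; apply/subvP => _ /memv_imgP[w wU ->]; exact: sU.
Qed.

Lemma eigen_kappa la v : s (kappa v) = la *: kappa v <->
  forall i, th (v 0 i) = la%:A * v 0 i.
Proof.
rewrite (ad_s ad) -(identZ idK); split.
  move/(ident_inj idK) => e i.
  by have /(congr1 (fun v : 'rV_3 => v 0 i)) := e; rewrite !mxE.
by move=> e; congr kappa; apply/rowP => i; rewrite !mxE e.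
Qed.

Lemma eigenP la c w : c != 0 -> th c = la%:A * c ->
  s w = la *: w <-> exists a, w = kappa (c *: map_mx (in_alg L) a).
Proof.
move=> c0 thc; split.
  have [v ->] := ident_surj idK w; move/eigen_kappa => e.
  have ev i : exists a, v 0 i == a%:A * c.
    have thc' : th c = la *: c by rewrite thc mulr_algl.
    have thv : th (v 0 i) = la *: v 0 i by rewrite e mulr_algl.
    have [a ->] := th_eigen hL th_nt c0 thc' thv.
    by exists a; rewrite mulr_algl.
  exists (\row_i xchoose (ev i)); congr kappa; apply/rowP => i; rewrite !mxE mulrC.
  exact/eqP/(xchooseP (ev i)).
move=> [a ->]; apply/eigen_kappa => i; rewrite !mxE rmorphM /= thc th_alg; ring.
Qed.

Lemma eigen_lin c x y z : kappa (c *: map_mx (in_alg L) (x *: y + z)) =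
  x *: kappa (c *: map_mx (in_alg L) y) + kappa (c *: map_mx (in_alg L) z).
Proof.
rewrite map_mxD map_mxZ scalerDr scalerA mulrC -scalerA; exact: idK.2.
Qed.

Lemma eigen_inj c z : c != 0 -> kappa (c *: map_mx (in_alg L) z) = 0 -> z = 0.
Proof.
move=> c0 /eqP; rewrite (ident_eq0 idK) scaler_eq0 (negPf c0) /= => /eqP e.
by apply: (map_mx_inj (f := in_alg L)); rewrite e map_mx0.
Qed.

Lemma dim_limg_shift la c : c != 0 -> th c = la%:A * c -> \dim (limg (shift la)) = 6%N.
Proof.
move=> c0 thc; have := limg_ker_dim (shift la) fullv.
rewrite capfv dim_full9.
suff -> : lker (shift la) = span3 (fun z => kappa (c *: map_mx (in_alg L) z)).
  rewrite (dim_span3 (eigen_lin c)) => [e|z /(eigen_inj c0) //].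
  exact: (@addnI 3).
apply/vspaceP => w; rewrite memv_ker shiftE subr_eq0.
apply/eqP/(span3P (eigen_lin c)) => /(eigenP w c0 thc) //.
Qed.

(** Modulo this image [s] is multiplication by [la], so every subspace that contains it is
    stable. *)
Lemma hwise_limg la c : c != 0 -> th c = la%:A * c ->
  hwise_fixed_5space s (limg (shift la)).
Proof.
move=> c0 thc; split; first exact: dim_limg_shift thc.
move=> Sg _ sub; apply: fixed_stable => w wS.
have -> : s w = shift la w + la *: w by rewrite shiftE subrK.
by rewrite memvD ?memvZ //; apply: (subvP sub); rewrite memv_img ?memvf.
Qed.

(** In the quotient by Pi every vector is an eigenvector of [s], so [s] acts there as a scalar. *)
Lemma hwise_scalar Pi : hwise_fixed_5space s Pi -> exists la, (limg (shift la) <= Pi)%VS.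
Proof.
move=> [dPi fPi].
have ex_out (W : {vspace 'rV[F]_9}) : (\dim W < 9)%N -> exists w, w \notin W.
  move=> ltW; have /subvPn[w _ wW] : ~~ (fullv <= W)%VS.
    by apply/negP => /dimvS; rewrite dim_full9 leqNgt ltW.
  by exists w.
have scal w : w \notin Pi -> exists2 a, s w - a *: w \in Pi & (s @: (Pi + <[w]>) = Pi + <[w]>)%VS.
  move=> wPi; have f : (s @: (Pi + <[w]>) = Pi + <[w]>)%VS.
    apply: fPi; last exact: addvSl.
    rewrite /proj_dim dimv_disjoint_sum ?dPi ?dim_vline.
      by case: eqVneq wPi => // ->; rewrite mem0v.
    apply/eqP; rewrite -subv0; apply/subvP => x /memv_capP[xPi /vlineP[k e]].
    have [k0|k0] := eqVneq k 0; first by rewrite e k0 scale0r mem0v.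
    by case/negP: wPi; rewrite -(scalerK k0 w) -e memvZ.
  have : s w \in (Pi + <[w]>)%VS by rewrite -f memv_img // (subvP (addvSr _ _)) ?memv_line.
  case/memv_addP => p pPi [_ /vlineP[a ->] e]; exists a => //.
  by rewrite e addrK.
have [w1 w1Pi] : exists w, w \notin Pi by apply: ex_out; rewrite dPi.
have [w2 w2Pi] : exists w, w \notin (Pi + <[w1]>)%VS.
  apply: ex_out; apply: leq_ltn_trans (dimv_add_leqif _ _) _.
  by rewrite dPi dim_vline; case: (_ != 0).
have indep x y w : w \notin (Pi + <[w1]>)%VS -> x *: w + y *: w1 \in Pi -> x = 0 /\ y = 0.
  move=> wP xy; have [x0|x0] := eqVneq x 0.
    split=> //; apply/eqP/negPn/negP => y0; case/negP: w1Pi.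
    by rewrite -(scalerK y0 w1) memvZ // -[y *: w1]add0r -(scale0r w) -x0.
  case/negP: wP; rewrite -(scalerK x0 w) memvZ //.
  rewrite -(addrK (y *: w1) (x *: w)) memvB //; first exact: (subvP (addvSl _ _)).
  by rewrite (subvP (addvSr _ _)) // memvZ ?memv_line.
have out w : w \notin (Pi + <[w1]>)%VS -> w \notin Pi.
  by apply: contra => wPi; rewrite (subvP (addvSl _ _)).
have [la sw1 f1] := scal _ w1Pi; have [b sw2 f2] := scal _ (out _ w2Pi).
(* Pi is the intersection of the two fixed 6-spaces that it spans with w1 and with w2. *)
have sPi w : w \in Pi -> s w \in Pi.
  move=> wPi.
  have : s w \in (Pi + <[w1]>)%VS by rewrite -f1 memv_img // (subvP (addvSl _ _)).
  have : s w \in (Pi + <[w2]>)%VS by rewrite -f2 memv_img // (subvP (addvSl _ _)).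
  case/memv_addP => p pPi [_ /vlineP[x ->] e] /memv_addP[p' p'Pi [_ /vlineP[y ->] e']].
  have [|x0 _] := indep x (- y) _ w2Pi; last by rewrite e x0 scale0r addr0.
  have -> : x *: w2 + (- y) *: w1 = p' - p; last by rewrite memvB.
  rewrite scaleNr; apply/eqP; rewrite subr_eq addrAC -e' e; apply/eqP.
  by rewrite addrAC subrr add0r.
exists la; apply/subvP => _ /memv_imgP[w _ ->]; rewrite shiftE.
have [/memv_addP[p pPi [_ /vlineP[x ->] ->]]|wP] := boolP (w \in (Pi + <[w1]>)%VS).
  rewrite linearD linearZ /= scalerDr scalerA [la * x]mulrC -scalerA.
  rewrite opprD addrACA -scalerBr memvD ?memvZ // memvB ?memvZ ?sPi //.
have [a sw _] := scal _ (out _ wP).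
(* The scalars of w and w1 agree, both being equal to the scalar of w + w1. *)
have wP' : w + w1 \notin (Pi + <[w1]>)%VS.
  apply: contra wP => h; rewrite -(addrK w1 w) memvB // (subvP (addvSr _ _)) //.
  exact: memv_line.
have [d sd _] := scal _ (out _ wP').
have [|ad0 ld0] := indep (a - d) (la - d) _ wP.
  have -> : (a - d) *: w + (la - d) *: w1 =
      (s (w + w1) - d *: (w + w1)) - (s w - a *: w) - (s w1 - la *: w1).
    rewrite linearD; apply/rowP => i; rewrite !mxE; ring.
  by rewrite memvB // memvB.
by have -> : la = a by rewrite -(subrK d a) ad0 -(subrK d la) ld0.
Qed.

(** As Pi is not the whole space, [s - la] has a nonzero kernel. A nonzero entry of an eigenvector
    serves as c; then the image of [s - la] has dimension 6 and fills Pi. *)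
Lemma hwise_limgE Pi : hwise_fixed_5space s Pi ->
  exists la c, [/\ c != 0, th c = la%:A * c, la ^+ 3 = 1 & Pi = limg (shift la)].
Proof.
move=> hPi; have [la sub] := hwise_scalar hPi; exists la.
have := memv_pick (lker (shift la)); set w := vpick _.
rewrite memv_ker shiftE subr_eq0 => /eqP sw.
have w0 : w != 0.
  rewrite /w vpick0 -dimv_eq0; have := limg_ker_dim (shift la) fullv.
  rewrite capfv dim_full9; have := dimvS sub; rewrite hPi.1.
  by case: (\dim (lker _)) => //; rewrite add0n => le e'; rewrite e' in le.
have [v ev] := ident_surj idK w.
have v0 : v != 0 by rewrite -(ident_eq0 idK) -ev.
case/rV0Pn: v0 => i vi; exists (v 0 i).
have thc : th (v 0 i) = la%:A * v 0 i.
  by move: i {vi}; apply/eigen_kappa; rewrite -ev.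
split=> //.
  have := s3 w; rewrite sw linearZ /= sw linearZ linearZ /= sw !scalerA => /eqP.
  rewrite -subr_eq0 -{2}(scale1r w) -scalerBl scaler_eq0 (negPf w0) orbF subr_eq0.
  by move/eqP => <-; ring.
by apply/esym/eqP; rewrite eqEdim sub hPi.1 (dim_limg_shift vi thc).
Qed.

End Hwise.

(** * Statistics of the standard planes *)

Section Stats.
Variables (F : finFieldType) (L : fieldExtType F)
  (P2q : {vspace 'rV[L]_3} -> Prop) (phi : {vspace 'rV[L]_3} -> {vspace 'rV[L]_3})
  (beta : 'rV[L]_3 -> 'rV[F]_9) (s : 'End('rV[F]_9)) (th : {lrmorphism L -> L})
  (kappa : 'rV[L]_3 -> 'rV[F]_9).
Hypothesis hL : \dim {:L}%VS = 3%N.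
Hypothesis th_nt : exists x, th x != x.
Hypotheses (ad : adapted P2q phi beta s th kappa) (s3 : forall w, s (s (s w)) = w).
Variables (dl : bool) (mu nu : F) (eps alp : L).
Hypothesis fr : frame th dl mu nu eps alp.

Let idK := ad_ident ad.
Local Notation q := #|F|.
Local Notation n := (~~ dl : nat).

Lemma hplane_dim h1 : \dim (hplane kappa h1 dl eps alp) = 3%N.
Proof. exact: dim_span3 (plane_map_lin ad h1 dl eps alp) (plane_map_inj0 ad fr (h1 := h1)). Qed.

(** The vectors of the plane are sums of [eps] and [alp] times vectors over F. By [fr_im] both
    factors are in the image of [th - la], so the plane is in the image of [s - la]. *)
Lemma hplane_h_plane h1 : h_plane s (hplane kappa h1 dl eps alp).
Proof.
split; first exact: hplane_dim.
- apply: (fixed_stable s3) => w /(hplaneP ad)[z ->].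
  by rewrite (s_plane_map ad _ fr); apply/(hplaneP ad); eexists.
(* This vector is moving for both values of [dl]. *)
- pose z : 'rV[F]_3 := vec3 1 0 1.
  have mz : moving dl z by rewrite /moving !vec3E oner_neq0 orbT.
  move=> ptw; have z0 := moving_nz mz.
  have uz0 : plane_map kappa h1 dl eps alp z != 0 by rewrite (plane_map_eq0 ad _ fr).
  have : fixed_point s <[plane_map kappa h1 dl eps alp z]>%VS.
    split; first exact/is_point_line.
    apply: ptw; first exact/is_point_line.
    by rewrite -memvE; apply/(hplaneP ad); exists z.
  by move/(fixed_plane_map ad s3 h1 fr z0); rewrite mz.
case: (fr_im fr) => la [c [y1 [y2 [c0 thc ey1 ey2]]]].
exists (limg (shift s la)); first exact: (hwise_limg hL th_nt ad s3 c0 thc).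
apply/subvP => _ /(hplaneP ad)[z ->].
have im (y : L) (v w : 'rV[F]_3) g : th y - la%:A * y = g ->
    kappa (g *: map_mx (in_alg L) v) \in limg (shift s la).
  move=> eg; have -> : kappa (g *: map_mx (in_alg L) v) =
      shift s la (kappa (y *: map_mx (in_alg L) v)).
    rewrite shiftE (ad_s ad) -(identZ idK) -scaleN1r.
    rewrite -(identZ idK) -(identD idK); congr kappa.
    rewrite map_mxZ map_th_alg scaleNr scale1r scaleN1r scalerA -scalerBl -eg //.
  by rewrite memv_img ?memvf.
have -> : plane_map kappa h1 dl eps alp z =
    kappa (eps *: map_mx (in_alg L) (vec3 (z 0 o0) (z 0 o1) ((~~ h1 && dl)%:R * z 0 o2))) +
    kappa (alp *: map_mx (in_alg L) (vec3 ((h1 || dl)%:R * z 0 o2) 0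
             ((~~ h1 && ~~ dl)%:R * z 0 o2))).
  rewrite -(identD idK); congr kappa; rewrite !map_vec3 !vec3Z vec3D /plane_row.
  by case: h1; case: dl; rewrite /= ?mulr1n ?mulr0n ?mul1r ?mul0r; congr vec3;
    rewrite -?in_algE ?rmorph0; ring.
by rewrite memvD //; [apply: (im y1)|apply: (im y2)].
Qed.

Lemma Idots_is_point A : Idots_point P2q beta s A -> is_point A.
Proof. by case=> -[]. Qed.

Lemma IIdots_is_point A : IIdots_point phi beta s A -> is_point A.
Proof. by case=> -[]. Qed.

Lemma contains_fixed_points h1 :
  contains_exactly (hplane kappa h1 dl eps alp) (fixed_point s) (q%:Z + 1 + n%:Z).
Proof.
apply: (contains_points ad fr (R := fun z => ~~ moving dl z)).
- by move=> A [].
- by move=> z; apply: (fixed_plane_map ad s3 _ fr).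
- exact: card_still.
Qed.

Lemma hplane_h1_plane : h1_plane P2q phi beta s n%:Z (hplane kappa true dl eps alp).
Proof.
have q1 := finNzRing_gt1 F.
have nq : (n <= q)%N by case: dl => //; apply: ltnW.
have nz_mov (p : pred 'rV[F]_3) :
    [set z | (z != 0) && (moving dl z && p z)] = [set z | moving dl z && p z].
  by apply/setP => z; rewrite !inE; case mz: (moving dl z); rewrite ?andbF // (moving_nz mz).
split; first exact: hplane_h_plane.
split.
  have [Pi HPi PiP] := ad_H ad (unitmx1 F 3); exists Pi => //.
  apply/subvP => _ /(hplaneP ad)[z ->].
  by have := PiP (plane_row true dl eps alp z); rewrite map_mx1 mulmx1 /plane_row vec3E; apply.
split; split.
- exact: contains_fixed_points.
- rewrite subzn //; apply: (contains_points ad fr (R := fun z => moving dl z && (z 0 o1 == 0))).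
  + exact: Idots_is_point.
  + by move=> z; apply: (plane_map_Idots ad s3 _ fr).
  + by rewrite nz_mov card_moving0.
- have -> : (q%:Z ^+ 2 - q%:Z) = (q ^ 2 - q)%N%:Z by move: #|F| q1 => r r1; nia.
  apply: (contains_points ad fr (R := fun z => moving dl z && (z 0 o1 != 0))).
  + exact: IIdots_is_point.
  + by move=> z; apply: (plane_map_IIdots ad _ fr).
  + by rewrite nz_mov card_moving_nz.
- exact: (contains_ptwise_line ad s3 _ fr).
(* The moving vectors with [z 0 o1 = 0] are exactly as many as one line contains. *)
- apply: (contains_lines ad s3 fr (Q := Idots_point P2q beta s) (p := id) (N := 1%N)).
  + by [].
  + exact: Idots_is_point.
  + by move=> z; apply: (plane_map_Idots ad s3 _ fr).
  + by rewrite card_moving0 mul1n.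
- have -> : (q%:Z - 1 + n%:Z) = (q - 1 + n)%N%:Z
    by move: #|F| q1 => r r1; case: dl => /=; lia.
  apply: (contains_lines ad s3 fr (Q := IIdots_point phi beta s) (p := negb)).
  + by [].
  + exact: IIdots_is_point.
  + by move=> z; apply: (plane_map_IIdots ad _ fr).
  + rewrite card_moving_nz; move: #|F| q1 => r r1; case: dl => /=; nia.
Qed.

Lemma hplane_h2_plane : h2_plane phi beta s n%:Z (hplane kappa false dl eps alp).
Proof.
have q1 := finNzRing_gt1 F.
have nz_mov : [set z : 'rV[F]_3 | (z != 0) && moving dl z] = [set z | moving dl z].
  by apply/setP => z; rewrite !inE; case mz: (moving dl z); rewrite ?andbF // (moving_nz mz).
split; first exact: hplane_h_plane.
split; split.
- exact: contains_fixed_points.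
- have -> : (q%:Z ^+ 2 - n%:Z) = (q ^ 2 - n)%N%:Z.
    by move: #|F| q1 => r r1; case: dl => /=; nia.
  apply: (contains_points ad fr (R := moving dl)).
  + exact: IIdots_is_point.
  + by move=> z z0; rewrite (plane_map_IIdots ad false fr z0) andbT.
  + by rewrite nz_mov card_moving.
- exact: (contains_ptwise_line ad s3 _ fr).
- have -> : (q%:Z + n%:Z) = (q + n)%N%:Z by [].
  apply: (contains_lines ad s3 fr (Q := IIdots_point phi beta s) (p := predT)).
  + by [].
  + exact: IIdots_is_point.
  + by move=> z z0; rewrite (plane_map_IIdots ad false fr z0) andbT.
  + have -> : [set z : 'rV[F]_3 | moving dl z && predT (z 0 o1 == 0)] = [set z | moving dl z].
      by apply/setP => z; rewrite !inE andbT.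
    rewrite card_moving; move: #|F| q1 => r r1; case: dl => /=; nia.
Qed.

End Stats.

(** * Classification of the h-planes *)

Lemma ex_notin_line (K : fieldType) (V : vectType K) (A : {vspace V}) (v : V) :
  \dim A = 2%N -> exists2 w, w \in A & w \notin <[v]>%VS.
Proof.
move=> dA; apply/subvPn; apply/negP => /dimvS; rewrite dA dim_vline.
by case: (v != 0).
Qed.

Lemma ex_third (F : fieldType) (a1 a2 : 'rV[F]_3) :
  exists b, b \notin (<[a1]> + <[a2]>)%VS.
Proof.
have /subvPn[b _ bA] : ~~ ({:'rV[F]_3} <= <[a1]> + <[a2]>)%VS.
  apply/negP => /dimvS.
  have d3 : \dim {:'rV[F]_3} = 3%N by rewrite dimvf.
  have := (dimv_add_leqif <[a1]> <[a2]>).1; rewrite !dim_vline d3.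
  by case: (a1 != 0); case: (a2 != 0) => le1 le2; have := leq_trans le2 le1.
by exists b.
Qed.

Lemma vec3_mul (R : nzRingType) x y z (M : 'M[R]_3) :
  vec3 x y z *m M = x *: row o0 M + y *: row o1 M + z *: row o2 M.
Proof. by rewrite mulmx_sum_row sum3 !vec3E. Qed.

Lemma unit_rows (F : fieldType) (a1 a2 b : 'rV[F]_3) :
    a1 != 0 -> a2 \notin <[a1]>%VS -> b \notin (<[a1]> + <[a2]>)%VS ->
  exists2 M : 'M[F]_3, M \in unitmx & [/\ row o0 M = a1, row o1 M = a2 & row o2 M = b].
Proof.
move=> a10 a2n bn.
pose M : 'M[F]_3 := \matrix_(i < 3) nth 0 [:: a1; a2; b] i.
have [r0 r1 r2] : [/\ row o0 M = a1, row o1 M = a2 & row o2 M = b].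
  by split; rewrite rowK.
exists M => //; rewrite -row_free_unit; apply: inj_row_free => v.
rewrite (vec3_eta v) vec3_mul r0 r1 r2 => e; rewrite -vec3_0.
have z0 : v 0 o2 = 0.
  apply/eqP/negPn/negP => z0; case/negP: bn.
  rewrite -(scalerK z0 b) memvZ //.
  have -> : v 0 o2 *: b = - (v 0 o0) *: a1 + - (v 0 o1) *: a2.
    by rewrite !scaleNr -opprD; apply/eqP; rewrite -addr_eq0 addrC e.
  by apply: memv_add; rewrite memvZ ?memv_line.
have y0 : v 0 o1 = 0.
  apply/eqP/negPn/negP => y0; case/negP: a2n.
  rewrite -(scalerK y0 a2) memvZ //; apply/vlineP; exists (- v 0 o0).
  by apply/eqP; rewrite scaleNr -addr_eq0 addrC -[X in _ == X]e z0 scale0r addr0.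
move: e; rewrite z0 y0 !scale0r !addr0 => /eqP; rewrite scaler_eq0 (negPf a10) orbF.
by move/eqP ->.
Qed.

(** A plane in the coordinates [twist kappa M] is the standard one with the rows of M in place of
    e1, e2, e3. *)
Definition twist (F : finFieldType) (L : fieldExtType F)
    (kappa : 'rV[L]_3 -> 'rV[F]_9) (M : 'M[F]_3) (v : 'rV[L]_3) :=
  kappa (v *m map_mx (in_alg L) M).

Section Classification.
Variables (F : finFieldType) (L : fieldExtType F)
  (P2q : {vspace 'rV[L]_3} -> Prop) (phi : {vspace 'rV[L]_3} -> {vspace 'rV[L]_3})
  (beta : 'rV[L]_3 -> 'rV[F]_9) (s : 'End('rV[F]_9)) (th : {lrmorphism L -> L})
  (kappa : 'rV[L]_3 -> 'rV[F]_9).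
Hypothesis hL : \dim {:L}%VS = 3%N.
Hypothesis th_nt : exists x, th x != x.
Hypotheses (ad : adapted P2q phi beta s th kappa) (s3 : forall w, s (s (s w)) = w).

Let idK := ad_ident ad.
Local Notation ia := (in_alg L).
(** The pure tensor of c and a, which [s] sends to that of [th c] and a. *)
Local Notation tn c a := (kappa (c *: map_mx (in_alg L) a)).

Lemma plane_map_twist h1 dl eps alp M z :
  plane_map (twist kappa M) h1 dl eps alp z =
  if h1 then kappa ((ia (z 0 o0) * eps + ia (z 0 o2) * alp) *: map_mx ia (row o0 M)
     + (ia (z 0 o1) * eps) *: map_mx ia (row o1 M))
  else if dl then kappa ((ia (z 0 o0) * eps + ia (z 0 o2) * alp) *: map_mx ia (row o0 M)
     + (ia (z 0 o1) * eps) *: map_mx ia (row o1 M) + (ia (z 0 o2) * eps) *: map_mx ia (row o2 M))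
  else kappa ((ia (z 0 o0) * eps) *: map_mx ia (row o0 M)
     + (ia (z 0 o1) * eps) *: map_mx ia (row o1 M) + (ia (z 0 o2) * alp) *: map_mx ia (row o2 M)).
Proof.
rewrite /plane_map /twist /plane_row; case: h1; [|case: dl];
by rewrite vec3_mul -!map_row ?scale0r ?addr0.
Qed.

Lemma hplane_twist_eq U h1 dl mu nu eps alp M : M \in unitmx ->
    frame th dl mu nu eps alp -> \dim U = 3%N ->
    tn eps (row o0 M) \in U -> tn eps (row o1 M) \in U ->
    (if h1 then tn alp (row o0 M)
     else if dl then kappa (alp *: map_mx ia (row o0 M) + eps *: map_mx ia (row o2 M))
     else tn alp (row o2 M)) \in U ->
  U = hplane (twist kappa M) h1 dl eps alp.
Proof.
move=> uM fr dU U0 U1 U2; have adM := adapted_mul uM ad.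
apply/esym/eqP; rewrite eqEdim (hplane_dim adM fr) dU leqnn andbT.
apply/span_subvP => w; rewrite !inE !plane_map_twist !vec3E rmorph0 rmorph1.
rewrite !mul0r !mul1r !scale0r !add0r !addr0 {fr}.
by case/or3P => /eqP ->; case: h1 U2; case: dl; rewrite ?scale0r ?add0r ?addr0.
Qed.

(** Rank and nullity of [s - mu] on U: its image lies in the kernel of [s - nu], so the dimensions
    of the two kernels add up to at least 3. Neither kernel is all of U, which is not pointwise
    fixed. *)
Lemma h_plane_kernels U mu nu : \dim U = 3%N -> (forall w, w \in U -> s w \in U) ->
    ~ ptwise_fixed s U ->
    (forall w, w \in U -> s (s w) - (mu + nu) *: s w + (mu * nu) *: w = 0) ->
  let d la := \dim (U :&: lker (shift s la)) in
  d mu = 2%N /\ (0 < d nu)%N \/ d nu = 2%N /\ (0 < d mu)%N.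
Proof.
move=> dU sU nptw quad d.
have dlt la : (d la < 3)%N.
  rewrite ltnNge; apply/negP => le3; apply: nptw => A /is_pointP[w w0 ->].
  rewrite -memvE => wU; apply/fixed_line => //.
  have : w \in (U :&: lker (shift s la))%VS.
    have /eqP -> // : (U :&: lker (shift s la))%VS == U.
    by rewrite eqEdim capvSl dU.
  rewrite memv_cap memv_ker shiftE subr_eq0 => /andP[_ /eqP ->].
  by rewrite memvZ ?memv_line.
have := limg_ker_dim (shift s mu) U; rewrite -/(d mu) dU => e.
have : (shift s mu @: U <= U :&: lker (shift s nu))%VS.
  apply/subvP => _ /memv_imgP[w wU ->]; rewrite memv_cap memv_ker !shiftE.
  rewrite memvB ?memvZ ?sU //= -[X in _ == X](quad w wU); apply/eqP.
  rewrite linearB linearZ; apply/rowP => i; rewrite !mxE /=; ring.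
move/dimvS; rewrite -/(d nu) => le; have := dlt mu; have := dlt nu.
by move: e le; move: (d mu) (d nu) (\dim _) => d1 d2 d3; lia.
Qed.

Lemma shift_stable U la : fixed s U -> forall w, w \in U -> shift s la w \in U.
Proof. by move=> fU w wU; rewrite shiftE memvB ?memvZ // -fU memv_img. Qed.

Lemma tensor_line c a1 a2 : c != 0 -> tn c a2 \in <[tn c a1]>%VS <-> a2 \in <[a1]>%VS.
Proof.
move=> c0; split=> /vlineP[k].
  rewrite -(lin3Z (eigen_lin ad c)) => /(lin3_inj (eigen_lin ad c)) ->.
    exact/memvZ/memv_line.
  by move=> z; apply: (eigen_inj ad).
by move=> ->; rewrite (lin3Z (eigen_lin ad c)) memvZ ?memv_line.
Qed.

Lemma tensor_eq0 c a : c != 0 -> (tn c a == 0) = (a == 0).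
Proof.
move=> c0; apply/eqP/eqP => [/(eigen_inj ad c0)//|->].
exact: (lin3_0 (eigen_lin ad c)).
Qed.

Lemma tensor_span (U : {vspace 'rV[F]_9}) c a1 a2 b : tn c a1 \in U -> tn c a2 \in U ->
  b \in (<[a1]> + <[a2]>)%VS -> tn c b \in U.
Proof.
move=> U1 U2 /memv_addP[_ /vlineP[x ->] [_ /vlineP[y ->] ->]].
by rewrite (eigen_lin ad) (lin3Z (eigen_lin ad c)) memvD ?memvZ.
Qed.

(** * Normal forms for q = 0 mod 3: the Artin-Schreier case *)

Section Char3.
Variable al : L.
Hypotheses (char3 : 3%:R = 0 :> F) (thal : th al = al + 1).

Lemma frame_char3 : frame th true 1 1 1 al.
Proof.
have c3L : 3%:R = 0 :> L by rewrite -(rmorph_nat (in_alg L)) char3 rmorph0.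
split.
- move=> x y e; have := congr1 th e.
  rewrite rmorphD !rmorphM /= !th_alg rmorph1 thal rmorph0 mulrDr addrA e add0r mulr1.
  move/eqP; rewrite -in_algE fmorph_eq0 => /eqP y0; move: e.
  by rewrite y0 scale0r mul0r addr0 mulr1 => /eqP; rewrite -in_algE fmorph_eq0 => /eqP.
- by rewrite rmorph1 scale1r mulr1.
- by rewrite scale1r !mul1r thal.
- by rewrite eqxx.
(* [th - 1] sends [al] to 1 and [al - al^2] to [-2 al], which is [al] in characteristic 3. *)
- exists 1, 1, al, (al - al ^+ 2); split.
  + exact: oner_neq0.
  + by rewrite rmorph1 scale1r mulr1.
  + by rewrite thal scale1r; ring.
  + rewrite rmorphB rmorphXn /= thal scale1r -[RHS](subr0 al).
    rewrite -(mul0r al) -c3L; ring.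
Qed.

(** For w in U not fixed by [s], the vector [(s - 1) w] is fixed, hence the tensor of 1 and some a1.
    Subtracting the tensor of [al] and a1 from w leaves a fixed vector, the tensor of 1 and some b.
    With a2 completing the kernel, the type is h1 or h2 according to whether b lies in <a1, a2>. *)
Lemma classification_char3 U : h_plane s U ->
  exists2 M, M \in unitmx & exists h1, U = hplane (twist kappa M) h1 true 1 al.
Proof.
move=> [dU fU nptw [Pi /(hwise_limgE hL th_nt ad s3)[la [c [c0 thc la3 ->]]] UPi]].
have fr := frame_char3.
have la1 : la = 1.
  have : (la - 1) ^+ 3 = la ^+ 3 - 1 - 3%:R * (la ^+ 2 - la) by ring.
  rewrite la3 char3 subrr mul0r subr0 => /eqP.
  by rewrite expf_eq0 /= subr_eq0 => /eqP.
rewrite {}la1 in thc UPi *.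
have sU w : w \in U -> s w \in U by move=> wU; rewrite -fU memv_img.
have quad w : w \in U -> s (s w) - (1 + 1) *: s w + (1 * 1) *: w = 0.
  move=> /(subvP UPi)/memv_imgP[y _ ->]; rewrite shiftE scale1r.
  rewrite !linearB /= s3.
  transitivity (3%:R *: (s y - s (s y))).
    apply/rowP => i; rewrite !mxE; ring.
  by rewrite char3 scale0r.
have dK : \dim (U :&: lker (shift s 1%R)) = 2%N.
  by case: (h_plane_kernels dU sU nptw quad) => -[].
have /subvPn[w wU wK] : ~~ (U <= lker (shift s 1%R))%VS.
  by apply/negP => /capv_idPl e; move: dK; rewrite e dU.
pose u1 := shift s 1 w; have u1E : s w = w + u1 by rewrite /u1 shiftE scale1r addrC subrK.
have u1U : u1 \in U by rewrite shift_stable.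
have u10 : u1 != 0 by rewrite /u1 -memv_ker.
have eig x : s x = 1 *: x <-> exists a, x = tn 1 a.
  by apply: (eigenP hL th_nt ad _ (oner_neq0 L)); rewrite rmorph1 scale1r mulr1.
have su1 : s u1 = 1 *: u1.
  have := quad w wU; rewrite u1E linearD /= u1E mul1r !scale1r => e.
  apply/eqP; rewrite -subr_eq0 -[X in _ == X]e; apply/eqP.
  by apply/rowP => i; rewrite !mxE; ring.
have [u2 u2K u2n] := ex_notin_line u1 dK.
move: u2K; rewrite memv_cap memv_ker shiftE subr_eq0 => /andP[u2U /eqP su2].
have /eig[a1 ea1] := su1; have /eig[a2 ea2] := su2.
have one0 := oner_neq0 L.
have a10 : a1 != 0 by rewrite -(tensor_eq0 _ one0) -ea1.
have a2n : a2 \notin <[a1]>%VS.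
  by apply/negP => /(tensor_line _ _ one0); rewrite -ea1 -ea2 (negPf u2n).
have /eig[b eb] : s (w - tn al a1) = 1 *: (w - tn al a1).
  rewrite linearB /= u1E (ad_s ad) map_mxZ map_th_alg /= thal scalerDl (identD idK) -ea1.
  by rewrite scale1r; apply/rowP => i; rewrite !mxE; ring.
have {}eb : w = tn al a1 + tn 1 b by rewrite -eb addrC subrK.
rewrite ea1 in u1U; rewrite ea2 in u2U.
have [bA|bA] := boolP (b \in (<[a1]> + <[a2]>)%VS).
  (* An h1-plane does not involve the third row, so any d completing a1, a2 to a basis will do. *)
  have [d dA] := ex_third a1 a2.
  have [M uM [r0 r1 r2]] := unit_rows a10 a2n dA; exists M => //; exists true.
  apply: (hplane_twist_eq uM fr dU); rewrite ?r0 ?r1 ?r2 //.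
  rewrite -(addrK (tn 1 b) (tn al a1)) -eb memvB //.
  exact: tensor_span bA.
have [M uM [r0 r1 r2]] := unit_rows a10 a2n bA; exists M => //; exists false.
apply: (hplane_twist_eq uM fr dU); rewrite ?r0 ?r1 ?r2 //.
by rewrite (identD idK) -eb.
Qed.
End Char3.

(** * Normal forms for q = 1 mod 3: the Kummer case *)

Section Kummer.
Variables (w : F) (al : L).
Hypotheses (w2 : w ^+ 2 + w + 1 = 0) (w1 : w != 1) (al0 : al != 0)
  (thal : th al = w *: al).

Lemma root_cubed : w ^+ 3 = 1.
Proof.
have e : w ^+ 3 - 1 = (w - 1) * (w ^+ 2 + w + 1) by ring.
by apply/eqP; rewrite -subr_eq0 e w2 mulr0.
Qed.

Lemma root_exp_inj (j k : 'I_3) : w ^+ j = w ^+ k -> j = k.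
Proof.
have w21 : w ^+ 2 != 1.
  by apply: contra w1 => /eqP e; have := root_cubed; rewrite exprS e mulr1 => ->.
have w0 : w != 0.
  by apply/eqP => w0; move/eqP: root_cubed; rewrite w0 expr0n eq_sym oner_eq0.
have w22 : w ^+ 2 != w.
  by apply: contra w1; rewrite expr2 -{3}(mulr1 w) => /eqP/(mulfI w0) ->.
move: j k; apply: ord3P => /=; apply: ord3P => //=; rewrite ?expr0 ?expr1 => /eqP;
by rewrite ?(negPf w1) ?(negPf w21) ?(negPf w22) // eq_sym ?(negPf w1) ?(negPf w21) ?(negPf w22).
Qed.

Lemma th_alX j : th (al ^+ j) = (w ^+ j)%:A * al ^+ j.
Proof. by rewrite rmorphXn /= thal exprZn mulr_algl. Qed.

Lemma third_index (j k : 'I_3) : j != k -> exists2 i : 'I_3, i != j & i != k.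
Proof.
move: j k; apply: ord3P => /=; apply: ord3P => //= _;
by [exists o0|exists o1|exists o2].
Qed.

Lemma frame_kummer (j k : 'I_3) : j != k ->
  frame th false (w ^+ j) (w ^+ k) (al ^+ j) (al ^+ k).
Proof.
move=> jk; have alX m : al ^+ m != 0 by rewrite expf_neq0.
have wn (i l : 'I_3) : i != l -> w ^+ i - w ^+ l != 0.
  by rewrite subr_eq0; apply: contra => /eqP/root_exp_inj ->.
split.
- move=> x y e; have := congr1 th e.
  rewrite rmorphD !rmorphM /= !th_alg !th_alX rmorph0 => e'.
  have /eqP : (w ^+ k - w ^+ j)%:A * y%:A * al ^+ k = 0.
    rewrite -[RHS](subrr 0) -{1}e' -(mulr0 (w ^+ j)%:A) -e -!in_algE rmorphB.
    ring.
  rewrite !mulf_eq0 (negPf (alX _)) orbF -!in_algE !fmorph_eq0.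
  have kj : w ^+ k - w ^+ j != 0 by apply: wn; rewrite eq_sym.
  rewrite (negPf kj) /= => /eqP y0; move: e.
  rewrite y0 scale0r mul0r addr0 => /eqP; rewrite mulf_eq0 (negPf (alX _)) orbF.
  by rewrite -in_algE fmorph_eq0 => /eqP.
- exact: th_alX.
- by rewrite th_alX mul0r addr0.
- by apply/negbTE; rewrite -subr_eq0 wn.
(* For the third exponent i, [th - w^i] multiplies [al^l] by [w^l - w^i], nonzero for l = j and l =
   k, so preimages are found by division. *)
- have [i ij ik] := third_index jk.
  exists (w ^+ i), (al ^+ i), (((w ^+ j - w ^+ i)^-1)%:A * al ^+ j),
    (((w ^+ k - w ^+ i)^-1)%:A * al ^+ k).
  have solve (l : 'I_3) : i != l -> th (((w ^+ l - w ^+ i)^-1)%:A * al ^+ l) -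
     (w ^+ i)%:A * (((w ^+ l - w ^+ i)^-1)%:A * al ^+ l) = al ^+ l.
    move=> il; rewrite rmorphM /= th_alg th_alX.
    transitivity (((w ^+ l)%:A - (w ^+ i)%:A) * ((w ^+ l - w ^+ i)^-1)%:A * al ^+ l).
      ring.
    rewrite -!in_algE -rmorphB -rmorphM mulfV ?rmorph1 ?mul1r //.
    by rewrite wn // eq_sym.
  split=> //; [exact: th_alX|exact: solve|exact: solve].
Qed.

Lemma cube_root_index (la : F) : la ^+ 3 = 1 -> exists i : 'I_3, la = w ^+ i.
Proof.
move=> la3; have : (la - 1) * ((la - w) * (la - w ^+ 2)) == 0.
  have -> : (la - 1) * ((la - w) * (la - w ^+ 2)) =
     la ^+ 3 - w ^+ 3 - (w ^+ 2 + w + 1) * (la ^+ 2 - w * la).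
    ring.
  by rewrite la3 root_cubed w2 mul0r subrr subr0.
rewrite !mulf_eq0 !subr_eq0 => /or3P[/eqP ->|/eqP ->|/eqP ->].
- by exists o0; rewrite expr0.
- by exists o1; rewrite expr1.
- by exists o2.
Qed.

(** The equations compare the coefficients of [X^3 - 1] with those of the product of its linear
    factors. *)
Lemma other_indices (i : 'I_3) : exists j k : 'I_3,
  [/\ j != k, w ^+ i + w ^+ j + w ^+ k = 0,
   w ^+ i * (w ^+ j + w ^+ k) + w ^+ j * w ^+ k = 0 & w ^+ i * (w ^+ j * w ^+ k) = 1].
Proof.
have e3 := root_cubed.
have e2 : w ^+ 3 + w ^+ 2 + w = 0 by rewrite e3 -w2; ring.
move: i; apply: ord3P; [exists o1, o2|exists o0, o2|exists o0, o1];
split=> //; [rewrite -[RHS]w2|rewrite -[RHS]e2|rewrite -[RHS]e3|rewrite -[RHS]w2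
  |rewrite -[RHS]e2|rewrite -[RHS]e3|rewrite -[RHS]w2|rewrite -[RHS]e2|rewrite -[RHS]e3];
rewrite /= ?expr0 ?expr1; ring.
Qed.

(** The two eigenspaces of [s] in U consist of pure tensors: of [al^j'] with <a1, a2>, and of
    [al^k'] with <b>. The position of b with respect to <a1, a2> decides the type. *)
Lemma classification_kummer U : h_plane s U ->
  exists2 M, M \in unitmx & exists h1 (j k : 'I_3),
    j != k /\ U = hplane (twist kappa M) h1 false (al ^+ j) (al ^+ k).
Proof.
move=> [dU fU nptw [Pi /(hwise_limgE hL th_nt ad s3)[la [c [c0 thc la3 ->]]] UPi]].
have alX m : al ^+ m != 0 by rewrite expf_neq0.
have [i lai] := cube_root_index la3; rewrite {}lai in thc UPi *.
have [j [k [jk e1 e2 e3]]] := other_indices i.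
have sU x : x \in U -> s x \in U by move=> xU; rewrite -fU memv_img.
have quad x : x \in U ->
    s (s x) - (w ^+ j + w ^+ k) *: s x + (w ^+ j * w ^+ k) *: x = 0.
  move=> /(subvP UPi)/memv_imgP[y _ ->]; rewrite shiftE.
  rewrite !linearB !linearZ /= linearZ /= s3.
  transitivity ((1 - w ^+ i * (w ^+ j * w ^+ k)) *: y
     - (w ^+ i + w ^+ j + w ^+ k) *: s (s y)
     + (w ^+ i * (w ^+ j + w ^+ k) + w ^+ j * w ^+ k) *: s y).
    apply/rowP => l; rewrite !mxE; ring.
  by rewrite e1 e2 e3 subrr !scale0r subrr addr0.
(* Either eigenvalue may be the one with the 2-dimensional eigenspace, so the pair of exponents is
   ordered. *)
have final (j' k' : 'I_3) : j' != k' ->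
    \dim (U :&: lker (shift s (w ^+ j'))) = 2%N ->
    (0 < \dim (U :&: lker (shift s (w ^+ k'))))%N ->
  exists2 M, M \in unitmx & exists h1 (j k : 'I_3),
    j != k /\ U = hplane (twist kappa M) h1 false (al ^+ j) (al ^+ k).
  move=> jk' dj dk; have fr := frame_kummer jk'.
  have [u1 u1K u1n] := ex_notin_line 0 dj.
  have u10 : u1 != 0 by apply: contra u1n => /eqP ->; rewrite mem0v.
  have [u2 u2K u2n] := ex_notin_line u1 dj.
  have [v vK v0] : exists2 v, v \in (U :&: lker (shift s (w ^+ k')%R))%VS & v != 0.
    exists (vpick (U :&: lker (shift s (w ^+ k')%R))%VS); first exact: memv_pick.
    by rewrite vpick0 -dimv_eq0 -lt0n.
  have mem l x : x \in (U :&: lker (shift s (w ^+ l)%R))%VS ->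
      x \in U /\ exists a, x = tn (al ^+ l) a.
    rewrite memv_cap memv_ker shiftE subr_eq0 => /andP[xU /eqP sx]; split=> //.
    exact/(eigenP hL th_nt ad _ (alX l) (th_alX l)).
  have [u1U [a1 ea1]] := mem _ _ u1K; have [u2U [a2 ea2]] := mem _ _ u2K.
  have [vU [b eb]] := mem _ _ vK.
  rewrite {}ea1 in u10 u2n u1U *; rewrite {}ea2 in u2n u2U *; rewrite {}eb in v0 vU *.
  have a10 : a1 != 0 by rewrite -(tensor_eq0 _ (alX j')).
  have b0 : b != 0 by rewrite -(tensor_eq0 _ (alX k')).
  have a2n : a2 \notin <[a1]>%VS.
    by apply/negP => /(tensor_line _ _ (alX j')); rewrite (negPf u2n).
  have [bA|bA] := boolP (b \in (<[a1]> + <[a2]>)%VS); last first.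
    have [M uM [r0 r1 r2]] := unit_rows a10 a2n bA; exists M => //; exists false, j', k'.
    by split=> //; apply: (hplane_twist_eq uM fr dU); rewrite ?r0 ?r1 ?r2.
  (* In type h1 the generator with [alp] sits on the first row, so b comes first; d completes it to
     a basis of <a1, a2>, and d' is any vector outside. *)
  have [d dA dn] := ex_notin_line b (dim_add_lines a10 a2n).
  have [d' d'n] := ex_third b d.
  have [M uM [r0 r1 r2]] := unit_rows b0 dn d'n; exists M => //; exists true, j', k'.
  split=> //; apply: (hplane_twist_eq uM fr dU); rewrite ?r0 ?r1 ?r2 //.
    exact: tensor_span bA.
  exact: tensor_span dA.
case: (h_plane_kernels dU sU nptw quad) => -[dj dk].
  exact: (final j k).
by apply: (final k j); rewrite // eq_sym.
Qed.
End Kummer.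
End Classification.

(** * Counting the h-planes *)

Section Stabilizers.
Variables (F : finFieldType).
Local Notation q := #|F|.
Let q1 : (1 < q)%N := finNzRing_gt1 F.

(* The subgroup of GL(3, F) fixing the plane of the given type on e1, e2, e3. *)
Definition stab (h1 dl : bool) (G : 'M[F]_3) : bool :=
  if h1 then [&& G o0 o1 == 0, G o0 o2 == 0 & G o1 o2 == 0]
  else if dl then
    [&& G o0 o1 == 0, G o0 o2 == 0, G o1 o2 == 0 & G o2 o2 == G o0 o0]
  else [&& G o0 o2 == 0, G o1 o2 == 0, G o2 o0 == 0 & G o2 o1 == 0].

Lemma card_unitmx n :
  #|[set M : 'M[F]_n.+1 | M \in unitmx]| =
  (q ^ 'C(n.+1, 2) * \prod_(1 <= i < n.+2) (q ^ i - 1))%N.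
Proof.
rewrite -card_GL // cardsT /= card_sub; apply: eq_card => M.
by rewrite !inE.
Qed.

Lemma card_GL3 : #|[set M : 'M[F]_3 | M \in unitmx]| =
  (q ^ 3 * ((q - 1) * ((q ^ 2 - 1) * (q ^ 3 - 1))))%N.
Proof.
rewrite card_unitmx; congr (_ * _)%N.
by rewrite big_ltn // big_ltn // big_ltn // big_geq // muln1 expn1.
Qed.

Lemma card_GL2 : #|[set M : 'M[F]_2 | M \in unitmx]| =
  (q * ((q - 1) * (q ^ 2 - 1)))%N.
Proof.
rewrite card_unitmx; congr (_ * _)%N.
by rewrite big_ltn // big_ltn // big_geq // muln1 expn1.
Qed.

(** The diagonal is [t.1] and the entries below it are [t.2]. Acting on row vectors, such matrices
    map <e1> and <e1, e2> into themselves. *)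
Definition lower (t : F * F * F * (F * F * F)) : 'M[F]_3 :=
  \matrix_(i < 3) nth 0 [:: vec3 t.1.1.1 0 0; vec3 t.2.1.1 t.1.1.2 0;
     vec3 t.2.1.2 t.2.2 t.1.2] i.

Lemma lower_inj : injective lower.
Proof.
move=> [[[a b] c] [[d e] f]] [[[a' b'] c'] [[d' e'] f']] E.
have := congr1 (row o0) E; have := congr1 (row o1) E; have := congr1 (row o2) E.
by rewrite !rowK /= => /vec3_inj[-> -> ->] /vec3_inj[-> -> _] /vec3_inj[-> _ _].
Qed.

Lemma lower_unit t : (lower t \in unitmx) =
  [&& t.1.1.1 != 0, t.1.1.2 != 0 & t.1.2 != 0].
Proof.
rewrite unitmxE unitfE det_trig.
  rewrite (big_ord_recl 2) (big_ord_recl 1) (big_ord_recl 0) big_ord0 mulr1 /=.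
  by rewrite !mxE /= ?mxE /= !mulf_eq0 !negb_or.
apply/is_trig_mxP; apply: ord3P; apply: ord3P; rewrite //= => _;
by rewrite !mxE /= ?mxE.
Qed.

Lemma lowerP (G : 'M[F]_3) : G o0 o1 = 0 -> G o0 o2 = 0 -> G o1 o2 = 0 ->
  G = lower (G o0 o0, G o1 o1, G o2 o2, (G o1 o0, G o2 o0, G o2 o1)).
Proof.
move=> e01 e02 e12; apply/matrixP; apply: ord3P; apply: ord3P;
by rewrite [RHS]mxE /= ?mxE.
Qed.

Lemma lower_entries t : [/\ lower t o0 o1 = 0, lower t o0 o2 = 0, lower t o1 o2 = 0,
  lower t o0 o0 = t.1.1.1 & lower t o2 o2 = t.1.2].
Proof. by split; rewrite mxE /= ?mxE. Qed.

(** A Borel subgroup, the stabilizer of a flag of PG(2, q); its index is (q + 1)(q^2 + q + 1). *)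
Lemma card_stab1 dl : #|[set G : 'M[F]_3 | (G \in unitmx) && stab true dl G]| =
  ((q - 1) ^ 3 * q ^ 3)%N.
Proof.
pose D : {set F * F * F * (F * F * F)} :=
  setX (setX (setX [set~ 0] [set~ 0]) [set~ 0]) [set: F * F * F].
have -> : [set G : 'M[F]_3 | (G \in unitmx) && stab true dl G] = lower @: D.
  apply/setP => G; rewrite inE /stab; apply/andP/imsetP.
    move=> [uG /and3P[/eqP e01 /eqP e02 /eqP e12]].
    have e := lowerP e01 e02 e12; eexists; last exact: e.
    by move: uG; rewrite {1}e lower_unit !inE /= andbT andbA.
  move=> [t tD ->]; have [-> -> -> _ _] := lower_entries t; rewrite !eqxx; split=> //.
  by move: tD; rewrite lower_unit !inE andbT andbA.
rewrite card_imset; last exact: lower_inj.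
rewrite !cardsX cardsT !card_prod !cardsC1 -subn1; move: #|F| q1 => r r1; nia.
Qed.

(** Compared with the Borel subgroup, the generator [alp e1 + eps e3] requires equal outer diagonal
    entries, which costs one factor q - 1. *)
Lemma card_stab2_char3 : #|[set G : 'M[F]_3 | (G \in unitmx) && stab false true G]| =
  ((q - 1) ^ 2 * q ^ 3)%N.
Proof.
pose D : {set F * F * (F * F * F)} :=
  setX (setX [set~ 0] [set~ 0]) [set: F * F * F].
pose f (t : F * F * (F * F * F)) := lower (t.1.1, t.1.2, t.1.1, t.2).
have -> : [set G : 'M[F]_3 | (G \in unitmx) && stab false true G] = f @: D.
  apply/setP => G; rewrite inE /stab; apply/andP/imsetP.
    move=> [uG /and4P[/eqP e01 /eqP e02 /eqP e12 /eqP e22]].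
    have e := lowerP e01 e02 e12; rewrite e22 in e.
    exists (G o0 o0, G o1 o1, (G o1 o0, G o2 o0, G o2 o1)) => //.
    by move: uG; rewrite {1}e lower_unit !inE /= andbT => /and3P[-> -> _].
  move=> [t tD ->]; have [-> -> -> -> ->] := lower_entries (t.1.1, t.1.2, t.1.1, t.2).
  rewrite !eqxx; split=> //; move: tD.
  by rewrite lower_unit !inE andbT /= => /andP[-> ->].
rewrite card_imset; last first.
  by move=> [[a b] c] [[a' b'] c'] /lower_inj /= [-> -> _ ->].
rewrite !cardsX cardsT !card_prod !cardsC1 -subn1; move: #|F| q1 => r r1; nia.
Qed.

(** The stabilizer of the antiflag of <e3> and <e1, e2> is the block diagonal group GL(2, F) times
    F^*. *)
Lemma card_stab2 : #|[set G : 'M[F]_3 | (G \in unitmx) && stab false false G]| =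
  (q * ((q - 1) * (q ^ 2 - 1)) * (q - 1))%N.
Proof.
pose f (p : 'M[F]_2 * F) : 'M[F]_(2 + 1) := block_mx p.1 0 0 p.2%:M.
pose D : {set 'M[F]_2 * F} := setX [set M | M \in unitmx] [set~ 0].
pose i0 : 'I_2 := @Ordinal 2 0 isT; pose i1 : 'I_2 := @Ordinal 2 1 isT.
have E0 : o0 = lshift 1 i0 by apply: val_inj.
have E1 : o1 = lshift 1 i1 by apply: val_inj.
have E2 : o2 = rshift 2 ord0 by apply: val_inj.
have R2 : rshift 2 (0 : 'I_1) = o2 by apply: val_inj.
have L0 (lt0 : (0 < 2)%N) : lshift 1 (Ordinal lt0) = o0 by apply: val_inj.
have L1 (lt1 : (1 < 2)%N) : lshift 1 (Ordinal lt1) = o1 by apply: val_inj.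
have f0 p : [/\ f p o0 o2 = 0, f p o1 o2 = 0, f p o2 o0 = 0 & f p o2 o1 = 0].
  split; [transitivity (f p (lshift 1 i0) (rshift 2 ord0))
    | transitivity (f p (lshift 1 i1) (rshift 2 ord0))
    | transitivity (f p (rshift 2 ord0) (lshift 1 i0))
    | transitivity (f p (rshift 2 ord0) (lshift 1 i1))];
  by rewrite -?E0 -?E1 -?E2 // E2 ?E0 ?E1 /f ?block_mxEur ?block_mxEdl mxE.
have fu p : (f p \in unitmx) = (p.1 \in unitmx) && (p.2 != 0).
  by rewrite /f !unitmxE (det_lblock p.1 0 p.2%:M) det_scalar1 !unitfE mulf_eq0 negb_or.
have -> : [set G : 'M[F]_3 | (G \in unitmx) && stab false false G] = f @: D.
  apply/setP => G; rewrite inE /stab; apply/andP/imsetP.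
    move=> [uG /and4P[/eqP e02 /eqP e12 /eqP e20 /eqP e21]].
    have e : G = f (ulsubmx (G : 'M_(2 + 1)), G o2 o2).
      have ur : ursubmx (G : 'M_(2 + 1)) = 0.
        apply/matrixP => i j; rewrite ord1 !mxE R2.
        case: i => -[|[|//]] lti.
          by rewrite L0.
        by rewrite L1.
      have dl : dlsubmx (G : 'M_(2 + 1)) = 0.
        apply/matrixP => i j; rewrite ord1 !mxE R2.
        case: j => -[|[|//]] lti.
          by rewrite L0.
        by rewrite L1.
      have dr : drsubmx (G : 'M_(2 + 1)) = (G o2 o2)%:M.
        apply/matrixP => i j; rewrite !ord1 !mxE eqxx mulr1n.
        by rewrite R2.
      by rewrite -[LHS](submxK (G : 'M_(2 + 1))) ur dl dr.
    exists (ulsubmx (G : 'M_(2 + 1)), G o2 o2) => //.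
    by move: uG; rewrite {1}e fu !inE.
  move=> [p pD ->]; have [-> -> -> ->] := f0 p; rewrite fu !eqxx.
  by move: pD; rewrite !inE.
rewrite card_imset; last first.
  move=> [A d] [A' d'] ; rewrite /f /= => /(@eq_block_mx _ 2 1 2 1)[-> _ _ e].
  by congr pair; have := congr1 (fun M : 'M_1 => M 0 0) e; rewrite !mxE eqxx.
by rewrite cardsX card_GL2 cardsC1 subn1.
Qed.
End Stabilizers.

Lemma unit_row_indep (F : fieldType) (G : 'M[F]_3) : G \in unitmx ->
  row o1 G \notin <[row o0 G]>%VS.
Proof.
move=> uG; apply/negP => /vlineP[k e].
have : vec3 (- k) 1 0 *m G = 0 *m G.
  by rewrite vec3_mul e scale1r scale0r addr0 scaleNr addNr mul0mx.
move/(can_inj (mulmxK uG)); rewrite -vec3_0 => /vec3_inj[_ /eqP].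
by rewrite oner_eq0.
Qed.

Lemma unit_row_neq0 (F : fieldType) (G : 'M[F]_3) i : G \in unitmx -> row i G != 0.
Proof.
move=> uG; apply/eqP; rewrite rowE -(mul0mx _ G) => /(can_inj (mulmxK uG)).
by move/matrixP/(_ 0 i)/eqP; rewrite !mxE !eqxx oner_eq0.
Qed.

(** * The case q = -1 mod 3 *)

Section NoHPlane.
Variables (F : finFieldType) (L : fieldExtType F)
  (P2q : {vspace 'rV[L]_3} -> Prop) (phi : {vspace 'rV[L]_3} -> {vspace 'rV[L]_3})
  (beta : 'rV[L]_3 -> 'rV[F]_9) (s : 'End('rV[F]_9)) (th : {lrmorphism L -> L})
  (kappa : 'rV[L]_3 -> 'rV[F]_9).
Hypothesis hL : \dim {:L}%VS = 3%N.
Hypothesis th_nt : exists x, th x != x.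
Hypotheses (ad : adapted P2q phi beta s th kappa) (s3 : forall w, s (s (s w)) = w).
Hypotheses (cube1 : forall x : F, x ^+ 3 = 1 -> x = 1) (char3 : 3%:R != 0 :> F).

(** Only [la = 1] occurs, so [s^2 + s + 1 = 0] on U, and an eigenvector w would give 3 w = 0. Each
    nonzero w spans with [s w] a stable 2-dimensional space [l w], which equals [l z] for every
    nonzero z in it. Two distinct such spaces inside U of dimension 3 would share a nonzero z. *)
Lemma no_h_plane U : ~ h_plane s U.
Proof.
move=> [dU fU _ [Pi /(hwise_limgE hL th_nt ad s3)[la [c [c0 thc la3 ->]]] UPi]].
rewrite (cube1 la3) in UPi.
have sU w : w \in U -> s w \in U by move=> wU; rewrite -fU memv_img.
have quad w : w \in U -> s (s w) = - s w - w.
  move=> /(subvP UPi)/memv_imgP[y _ ->]; rewrite shiftE scale1r !linearB /= s3.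
  by apply/rowP => i; rewrite !mxE; ring.
have noeig w : w \in U -> w != 0 -> s w \notin <[w]>%VS.
  move=> wU w0; apply/negP => /vlineP[k sw].
  have k1 : k = 1.
    apply: cube1; have := s3 w; rewrite sw linearZ /= sw linearZ linearZ /= sw !scalerA => /eqP.
    rewrite -subr_eq0 -{2}(scale1r w) -scalerBl scaler_eq0 (negPf w0) orbF subr_eq0.
    by move/eqP => <-; ring.
  have := quad w wU; rewrite sw k1 !scale1r sw k1 scale1r => e.
  have : 3%:R *: w = w - (- w - w) by apply/rowP => i; rewrite !mxE; ring.
  rewrite -e subrr => /eqP; by rewrite scaler_eq0 (negPf char3) (negPf w0).
pose l w := (<[w]> + <[s w]>)%VS.
have dl w : w \in U -> w != 0 -> \dim (l w) = 2%N.
  by move=> wU w0; apply: dim_add_lines; rewrite ?noeig.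
have lU w : w \in U -> (l w <= U)%VS by move=> wU; rewrite subv_add -!memvE wU sU.
have ls w z : w \in U -> z \in l w -> s z \in l w.
  move=> wU /memv_addP[_ /vlineP[a ->] [_ /vlineP[b ->] ->]].
  rewrite linearD !linearZ /= quad // scalerBr scalerN.
  have -> : a *: s w + (- (b *: s w) - b *: w) = - b *: w + (a - b) *: s w.
    by apply/rowP => i; rewrite !mxE; ring.
  by apply: memv_add; rewrite memvZ ?memv_line.
have lz w z : w \in U -> w != 0 -> z \in l w -> z != 0 -> l z = l w.
  move=> wU w0 zl z0; have zU := subvP (lU w wU) z zl.
  by apply/eqP; rewrite eqEdim !dl // leqnn andbT subv_add -!memvE zl ls.
have x0 : vpick U != 0 by rewrite vpick0 -dimv_eq0 dU.
have xU := memv_pick U; set x := vpick U in x0 xU.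
have /subvPn[y yU yl] : ~~ (U <= l x)%VS.
  by apply/negP => /dimvS; rewrite dl // dU.
have y0 : y != 0 by apply: contraNneq yl => ->; rewrite mem0v.
have : (l x :&: l y)%VS != 0%VS.
  rewrite -dimv_eq0; have := dimv_sum_cap (l x) (l y); rewrite !dl //.
  have sub : (l x + l y <= U)%VS by rewrite subv_add !lU.
  have := dimvS sub; rewrite dU.
  by move: (\dim (_ + _)) (\dim (_ :&: _)) => d1 d2; lia.
rewrite -vpick0; have := memv_pick (l x :&: l y)%VS; set z := vpick _.
rewrite memv_cap => /andP[zx zy] z0.
by case/negP: yl; rewrite -(lz _ _ xU x0 zx z0) (lz _ _ yU y0 zy z0) memvE addvSl.
Qed.
End NoHPlane.

(** * Orbits and stabilizers of the standard planes *)

Section PlaneCount.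
Variables (F : finFieldType) (L : fieldExtType F)
  (P2q : {vspace 'rV[L]_3} -> Prop) (phi : {vspace 'rV[L]_3} -> {vspace 'rV[L]_3})
  (beta : 'rV[L]_3 -> 'rV[F]_9) (s : 'End('rV[F]_9)) (th : {lrmorphism L -> L}).
Local Notation ia := (in_alg L).

Section Stab.
Variable kappa : 'rV[L]_3 -> 'rV[F]_9.
Hypothesis ad : adapted P2q phi beta s th kappa.
Let idK := ad_ident ad.
Local Notation tn c a := (kappa (c *: map_mx (in_alg L) a)).

Lemma scale_row3 c (r : 'rV[F]_3) : c *: map_mx ia r =
  vec3 (ia (r 0 o0) * c) (ia (r 0 o1) * c) (ia (r 0 o2) * c).
Proof. by rewrite {1}(vec3_eta r) map_vec3 vec3Z; congr vec3; rewrite mulrC. Qed.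

Section OneFrame.
Variables (h1 dl : bool) (mu nu : F) (eps alp : L).
Hypothesis fr : frame th dl mu nu eps alp.
Local Notation U := (hplane kappa h1 dl eps alp).

Lemma mem_hplane v : kappa v \in U <-> exists z, v = plane_row h1 dl eps alp z.
Proof.
split=> [/(hplaneP ad)[z /(ident_inj idK) e]|[z ->]]; first by exists z.
by apply/(hplaneP ad); exists z.
Qed.

Lemma frame_uniq x y x' y' : ia x * eps + ia y * alp = ia x' * eps + ia y' * alp ->
  x = x' /\ y = y'.
Proof.
move=> e; have [] := @fr_free _ _ _ _ _ _ _ _ fr (x - x') (y - y').
  by rewrite -!in_algE !rmorphB !mulrBl addrACA -opprD e subrr.
by move=> /eqP; rewrite subr_eq0 => /eqP -> /eqP; rewrite subr_eq0 => /eqP.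
Qed.

Lemma frame_uniq_eps x x' y' : ia x * eps = ia x' * eps + ia y' * alp -> x = x' /\ y' = 0.
Proof.
move=> e; have [] := @frame_uniq x 0 x' y'; first by rewrite rmorph0 mul0r addr0.
by move=> -> ->.
Qed.

Lemma frame_uniq_alp y x' y' : ia y * alp = ia x' * eps + ia y' * alp -> x' = 0 /\ y' = y.
Proof.
move=> e; have [] := @frame_uniq 0 y x' y'; first by rewrite rmorph0 mul0r add0r.
by move=> -> ->.
Qed.

(** Together with [hplane_third_gen_mem], this turns the membership of the generators of a twisted
    plane into the equations of [stab]. *)
Lemma tensor_eps_mem r : tn eps r \in U <-> r 0 o2 = 0.
Proof.
rewrite mem_hplane scale_row3 /plane_row; split.
  move=> [z]; case: h1; [|case: dl] => /vec3_inj[e0 e1 e2].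
  - have [|//] := @frame_uniq_eps (r 0 o2) 0 0; by rewrite e2 rmorph0 !mul0r addr0.
  - have [_ z2] := frame_uniq_eps e0; have [|//] := @frame_uniq_eps (r 0 o2) 0 0.
    by rewrite e2 z2 rmorph0 !mul0r addr0.
  - have [|//] := @frame_uniq_eps (r 0 o2) 0 (z 0 o2).
    by rewrite e2 rmorph0 mul0r add0r.
move=> r2; exists (vec3 (r 0 o0) (r 0 o1) 0); rewrite !vec3E r2 rmorph0 !mul0r !addr0.
by case: h1; case: dl.
Qed.

Lemma hplane_third_gen_mem (r t : 'rV[F]_3) :
  (if h1 then tn alp r else if dl then kappa (alp *: map_mx ia r + eps *: map_mx ia t)
   else tn alp t) \in U <->
  (if h1 then r 0 o1 = 0 /\ r 0 o2 = 0 else if dl then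
     [/\ r 0 o1 = 0, r 0 o2 = 0 & t 0 o2 = r 0 o0] else t 0 o0 = 0 /\ t 0 o1 = 0).
Proof.
have P := mem_hplane; move: P; rewrite /plane_row.
have alp0 y : ia y * alp = 0 -> y = 0.
  move=> e; have [] := @frame_uniq 0 y 0 0; last by [].
  by rewrite rmorph0 !mul0r !add0r.
case: h1; [|case: dl] => P; rewrite P !scale_row3.
- split=> [[z /vec3_inj[e0 e1 e2]]|[r1 r2]].
    split; last exact: alp0.
    by have [] := @frame_uniq_alp (r 0 o1) (z 0 o1) 0; rewrite ?rmorph0 ?mul0r ?addr0.
  by exists (vec3 0 0 (r 0 o0)); rewrite !vec3E r1 r2 rmorph0 !mul0r add0r.
- rewrite vec3D; split=> [[z /vec3_inj[e0 e1 e2]]|[r1 r2 tr]].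
    have [_ z2] := @frame_uniq (t 0 o0) (r 0 o0) _ _ (etrans (addrC _ _) e0).
    have [] := @frame_uniq (t 0 o1) (r 0 o1) (z 0 o1) 0.
      by rewrite addrC e1 rmorph0 mul0r addr0.
    move=> _ r1; have [] := @frame_uniq (t 0 o2) (r 0 o2) (z 0 o2) 0.
      by rewrite addrC e2 rmorph0 mul0r addr0.
    by move=> t2 r2; rewrite t2 z2.
  exists (vec3 (t 0 o0) (t 0 o1) (r 0 o0)); rewrite !vec3E r1 r2 tr rmorph0 !mul0r !add0r.
  by rewrite addrC.
- split=> [[z /vec3_inj[e0 e1 e2]]|[t0 t1]].
    by split; [have [] := @frame_uniq_alp (t 0 o0) (z 0 o0) 0
      |have [] := @frame_uniq_alp (t 0 o1) (z 0 o1) 0]; rewrite ?rmorph0 ?mul0r ?addr0.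
  by exists (vec3 0 0 (t 0 o2)); rewrite !vec3E t0 t1 rmorph0 !mul0r.
Qed.

Lemma twist_gens eps' alp' (G : 'M[F]_3) : hplane (twist kappa G) h1 dl eps' alp' = U ->
  [/\ tn eps' (row o0 G) \in U, tn eps' (row o1 G) \in U &
    (if h1 then tn alp' (row o0 G)
     else if dl then kappa (alp' *: map_mx ia (row o0 G) + eps' *: map_mx ia (row o2 G))
     else tn alp' (row o2 G)) \in U].
Proof.
move=> <-; split; apply: memv_span; rewrite !inE !plane_map_twist !vec3E rmorph0 rmorph1;
rewrite !mul0r !mul1r !scale0r ?add0r ?addr0; case: h1; case: dl;
by rewrite ?scale0r ?add0r ?addr0 ?eqxx ?orbT.
Qed.

Lemma stabP G : G \in unitmx -> hplane (twist kappa G) h1 dl eps alp = U <-> stab h1 dl G.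
Proof.
move=> uG; split.
  case/twist_gens => /tensor_eps_mem g0 /tensor_eps_mem g1 /hplane_third_gen_mem; move: g0 g1; rewrite /stab !mxE.
  case: h1; [|case: dl] => -> -> []; rewrite ?eqxx.
  - by move=> -> _; rewrite eqxx.
  - by move=> -> _ ->; rewrite !eqxx.
  - by move=> -> ->; rewrite eqxx.
move=> st; apply/esym; apply: (hplane_twist_eq ad uG fr (hplane_dim ad fr h1));
  [apply/tensor_eps_mem|apply/tensor_eps_mem|apply/hplane_third_gen_mem]; move: st; rewrite /stab !mxE;
case: h1; case: dl;
by [case/and3P => /eqP ? /eqP ? /eqP ?|case/and4P => /eqP ? /eqP ? /eqP ? /eqP ?].
Qed.
End OneFrame.

(** If [dl] fails, the plane determines its pair of eigenvalues in order: [mu] is the one with a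
    2-dimensional eigenspace in the plane, and [nu] is the other. *)
Lemma frame_rigid h1 mu nu eps alp mu' nu' eps' alp' G : G \in unitmx ->
    frame th false mu nu eps alp -> frame th false mu' nu' eps' alp' ->
    hplane (twist kappa G) h1 false eps' alp' = hplane kappa h1 false eps alp ->
  mu' = mu /\ nu' = nu.
Proof.
move=> uG fr fr' e; have [g0 g1 g2] := twist_gens e.
have nz_frame (x y : F) : (x != 0) || (y != 0) -> ia x * eps' + ia y * alp' != 0.
  apply: contraL => /eqP/(fr_free fr')[-> ->]; by rewrite eqxx.
have eps0 : eps' != 0.
  by have := nz_frame 1 0; rewrite oner_neq0 rmorph1 rmorph0 mul1r mul0r addr0; apply.
have alp0 : alp' != 0.
  by have := nz_frame 0 1; rewrite oner_neq0 orbT rmorph1 rmorph0 mul1r mul0r add0r; apply.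
have eig c la r : th c = la%:A * c -> c != 0 -> r != 0 ->
    tn c r \in hplane kappa h1 false eps alp ->
  exists2 z, tn c r = plane_map kappa h1 false eps alp z &
    (la = mu /\ z 0 o2 = 0) \/ (la = nu /\ z = vec3 0 0 (z 0 o2)).
  move=> thc c0 r0 /(hplaneP ad)[z ez]; exists z => //.
  have sz : act false mu nu z = la *: z.
    apply: (plane_map_inj ad (h1 := h1) fr); rewrite -(s_plane_map ad _ fr) -ez (lin3Z (plane_map_lin ad _ _ _ _)) -ez.
    apply/(eigen_kappa ad) => i; rewrite !mxE rmorphM /= thc th_alg; ring.
  have z0 : z != 0.
    rewrite -(plane_map_eq0 ad h1 fr) -ez (ident_eq0 idK) scaler_eq0 (negPf c0) /=.
    by apply: contra r0 => /eqP e0; apply/eqP/(map_mx_inj (f := ia)); rewrite e0 map_mx0.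
  have : ~~ moving false z by apply/(movingP fr); exists la.
  rewrite /moving negb_and negbK /= negb_or !negbK => H.
  move: sz; rewrite {2}(vec3_eta z) vec3Z /act => /vec3_inj[].
  rewrite mul0r addr0 => s0 s1 s2.
  have [z2|z2] := eqVneq (z 0 o2) 0.
    left; split=> //; have : (z 0 o0 != 0) || (z 0 o1 != 0).
      rewrite -negb_and; apply: contra z0 => /andP[/eqP e0 /eqP e1].
      by rewrite (vec3_eta z) e0 e1 z2 vec3_0.
    by case/orP=> nz; apply/esym; [exact: mulIf s0|exact: mulIf s1].
  right; split; first by apply/esym; exact: mulIf s2.
  case/orP: H => [/eqP z2'|/andP[/eqP e0 /eqP e1]]; first by rewrite z2' eqxx in z2.
  by rewrite {1}(vec3_eta z) e0 e1.
have thn : th alp' = nu'%:A * alp' by rewrite (fr_alp fr') mul0r addr0.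
have r0 := unit_row_neq0 o0 uG; have r1 := unit_row_neq0 o1 uG; have r2 := unit_row_neq0 o2 uG.
(* Two independent eigenvectors cannot both lie in the eigenspace of [nu], which is spanned by the
   vector of coordinates (0, 0, 1). *)
have mue : mu' = mu.
  have [z ez [[//]|[_ zE]]] := eig _ _ _ (fr_eps fr') eps0 r0 g0.
  have [z' ez' [[//]|[_ zE']]] := eig _ _ _ (fr_eps fr') eps0 r1 g1.
  have z2 : z 0 o2 != 0.
    apply/eqP => z2; move/eqP: ez; rewrite zE z2 vec3_0 (lin3_0 (plane_map_lin ad _ _ _ _)).
    by rewrite (tensor_eq0 ad _ eps0) (negPf r0).
  case/negP: (unit_row_indep uG); apply/(tensor_line ad _ _ eps0); rewrite ez ez'.
  apply/(plane_map_line_mem ad _ fr); exists (z' 0 o2 / z 0 o2).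
  by rewrite zE' zE vec3Z !vec3E !mulr0 divfK.
split=> //.
have gr : exists2 r, r != 0 & tn alp' r \in hplane kappa h1 false eps alp.
  by case: ifP g2 => _ g2; [exists (row o0 G)|exists (row o2 G)].
case: gr => r rn gr; have [z _ [[numu _]|[//]]] := eig _ _ _ thn alp0 rn gr.
by have := fr_dl fr'; rewrite mue numu eqxx.
Qed.
End Stab.

Variable kappa : 'rV[L]_3 -> 'rV[F]_9.
Hypothesis ad : adapted P2q phi beta s th kappa.

(** Orbit counting: the plane of a pair (i, M) determines i, and the matrices M that give it form a
    coset of the stabilizer. If [dl] holds, [rigid] says that V has at most one element; otherwise i
    is recovered from the eigenvalues by [frame_rigid]. *)
Lemma count_planes (J : finType) (V : {set J}) (dl h1 : bool) (mu nu : J -> F)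
    (eps alp : J -> L) (P : {vspace 'rV[F]_9} -> Prop) N :
    (forall i, i \in V -> frame th dl (mu i) (nu i) (eps i) (alp i)) ->
    (forall i i', i \in V -> i' \in V -> (~~ dl -> mu i' = mu i /\ nu i' = nu i) -> i' = i) ->
    (forall U, P U <-> exists i M, [/\ i \in V, M \in unitmx &
        U = hplane (twist kappa M) h1 dl (eps i) (alp i)]) ->
    (#|V| * #|[set M : 'M[F]_3 | M \in unitmx]|)%N =
      (N * #|[set G : 'M[F]_3 | (G \in unitmx) && stab h1 dl G]|)%N ->
  has_card P N%:Z.
Proof.
move=> frV rigid PE cardE.
apply: (has_card_fiber (f := fun iM : J * 'M[F]_3 =>
    hplane (twist kappa iM.2) h1 dl (eps iM.1) (alp iM.1))
  (D := setX V [set M | M \in unitmx])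
  (k := #|[set G : 'M[F]_3 | (G \in unitmx) && stab h1 dl G]|)).
- apply/card_gt0P; exists 1%:M; rewrite inE unitmx1 /stab !mxE /=.
  by case: (h1); case: (dl); rewrite !eqxx.
- move=> U; rewrite PE; split.
    by move=> [i [M [iV uM ->]]]; exists (i, M); rewrite // !inE iV.
  by move=> [[i M]]; rewrite !inE /= => /andP[iV uM] <-; exists i, M.
- move=> [i M]; rewrite !inE /= => /andP[iV uM].
  have adM := adapted_mul uM ad.
  (* Comparing the planes of G M and M amounts to comparing those of G and 1 in the coordinates
     twisted by M, where [stabP] applies. *)
  have twE G e a : hplane (twist kappa (G *m M)) h1 dl e a =
      hplane (twist (twist kappa M) G) h1 dl e a.
    by rewrite /hplane /span3 /plane_map /twist map_mxM !mulmxA.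
  rewrite -(card_imset (f := fun G => (i, G *m M))); last first.
    by move=> G G' [/(can_inj (mulmxK uM))].
  apply: eq_card => -[i' M']; rewrite !inE /=; apply/andP/imsetP.
    move=> [/andP[i'V uM'] /eqP]; pose G := M' *m invmx M.
    have eM : M' = G *m M by rewrite mulmxKV.
    have uG : G \in unitmx by rewrite unitmx_mul uM' unitmx_inv.
    rewrite eM twE => e.
    have ii : i' = i.
      apply: rigid => // ndl; have fr := frV _ iV; have fr' := frV _ i'V.
      rewrite (negPf ndl) in fr fr' e.
      exact: (frame_rigid adM uG fr fr' e).
    exists G; last by rewrite ii.
    rewrite inE uG; apply/(stabP adM h1 (frV _ iV) uG); by rewrite -e ii.
  move=> [G]; rewrite inE => /andP[uG st] [-> ->].
  by rewrite iV unitmx_mul uG uM twE; split=> //; apply/eqP/(stabP adM h1 (frV _ iV) uG).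
by rewrite cardsX.
Qed.
End PlaneCount.

(** * Cube roots of unity in F *)

Section CubeRoots.
Variable F : finFieldType.

Lemma finField_char3 : (3%:R == 0 :> F) = (3 %| #|F|)%N.
Proof.
have [p pr_p pF] := finPcharP F.
rewrite -(dvdn_pcharf pF) dvdn_prime2 // eq_sym.
have cF : #|F| = (p ^ logn p #|F|)%N := card_pprimeChar pF.
rewrite cF Euclid_dvdX // dvdn_prime2 //.
case: (logn p #|F|) cF => [|k _]; last by rewrite andbT.
by have := finNzRing_gt1 F; rewrite expn0 => /[swap] ->.
Qed.

(** If q = 3 m + 2 and x^3 = 1, then x = x^q = x^2. *)
Lemma cube_root_trivial : #|F| = 2 %[mod 3] -> forall x : F, x ^+ 3 = 1 -> x = 1.
Proof.
move=> q2 x x3; have x0 : x != 0.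
  by apply/eqP => x0; move/eqP: x3; rewrite x0 expr0n eq_sym oner_eq0.
have := expf_card x; rewrite (divn_eq #|F| 3) q2 exprD mulnC exprM x3 expr1n mul1r.
by rewrite expr2 -{3}(mulr1 x) => /(mulfI x0).
Qed.

(** With q - 1 = 3 m, the polynomial X^m - 1 has at most m roots, so some nonzero x has x^m <> 1,
    and x^m is the desired root. *)
Lemma cube_root_exists : #|F| = 1 %[mod 3] ->
  exists2 w : F, w ^+ 2 + w + 1 = 0 & w != 1.
Proof.
move=> q1; have F1 := finNzRing_gt1 F.
pose m := (#|F| %/ 3)%N; have qE : #|F| = (m * 3 + 1)%N by rewrite {1}(divn_eq #|F| 3) q1.
have m0 : (0 < m)%N by move: F1; rewrite qE; case: (m).
have [x x0 xm] : exists2 x : F, x != 0 & x ^+ m != 1.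
  have [/existsP[x /andP[x0 xm]]|] := boolP [exists x : F, (x != 0) && (x ^+ m != 1)].
    by exists x.
  rewrite negb_exists => /forallP all1.
  have := @max_unity_roots F m (enum [set x : F | x != 0]) m0.
  rewrite -cardE card_nz enum_uniq qE addnK => /(_ _ isT) H.
  suff : (m * 3 <= m)%N by move: m0; lia.
  apply: H; apply/allP => x; rewrite mem_enum inE => x0.
  by have := all1 x; rewrite x0 negbK unity_rootE.
exists (x ^+ m) => //.
have x1 : x ^+ (m * 3) = 1.
  by apply: (mulfI x0); rewrite mulr1 -exprS -addn1 -qE expf_card.
have e : (x ^+ m - 1) * ((x ^+ m) ^+ 2 + x ^+ m + 1) = 0.
  transitivity ((x ^+ m) ^+ 3 - 1); first ring.
  by rewrite -exprM x1 subrr.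
by move/eqP: e; rewrite mulf_eq0 subr_eq0 (negPf xm) => /eqP.
Qed.
End CubeRoots.

Lemma modz3_nat (q : nat) (n : int) :
  (q%:Z = n %[mod 3])%Z -> n \in [:: -1; 0; 1] ->
  [\/ n = -1 /\ q = 2 %[mod 3], n = 0 /\ q = 0 %[mod 3] | n = 1 /\ q = 1 %[mod 3]].
Proof.
move=> hq; rewrite !inE => /or3P[] /eqP en; subst n;
  [apply: Or31|apply: Or32|apply: Or33]; split=> //; lia.
Qed.

(** The types differ in the number of II-points whose images are collinear with them: q^2 - q
    against q^2 - n, where n <= 1 < q. *)
Lemma h1_h2_exclusive (F : finFieldType) (L : fieldExtType F) P2q phi
    (beta : 'rV[L]_3 -> 'rV[F]_9) s (dl : bool) U :
  ~ (h1_plane P2q phi beta s (~~ dl : nat)%:Z U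
     /\ h2_plane phi beta s (~~ dl : nat)%:Z U).
Proof.
move=> [[_ [_ [[_ _ c1] _]]] [_ [[_ c2] _]]].
have := has_card_inj c1 c2; have := finNzRing_gt1 F.
by move: #|F| {c1 c2} => r r1; case: dl => /=; lia.
Qed.

(** * Both types together: classification and numbers *)

Section Assembly.
Variables (F : finFieldType) (L : fieldExtType F)
  (P2q : {vspace 'rV[L]_3} -> Prop) (phi : {vspace 'rV[L]_3} -> {vspace 'rV[L]_3})
  (beta : 'rV[L]_3 -> 'rV[F]_9) (s : 'End('rV[F]_9)) (th : {lrmorphism L -> L})
  (kappa : 'rV[L]_3 -> 'rV[F]_9).
Hypothesis hL : \dim {:L}%VS = 3%N.
Hypothesis th_nt : exists x, th x != x.
Hypotheses (ad : adapted P2q phi beta s th kappa) (s3 : forall w, s (s (s w)) = w).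
Variables (dl : bool) (J : finType) (V : {set J}) (mu nu : J -> F) (eps alp : J -> L).
Hypothesis frV : forall i, i \in V -> frame th dl (mu i) (nu i) (eps i) (alp i).
Hypothesis rigid : forall i i', i \in V -> i' \in V ->
  (~~ dl -> mu i' = mu i /\ nu i' = nu i) -> i' = i.
Hypothesis classif : forall U, h_plane s U -> exists h1 i M,
  [/\ i \in V, M \in unitmx & U = hplane (twist kappa M) h1 dl (eps i) (alp i)].

Local Notation q := #|F|.
Local Notation n := (~~ dl : nat).
Local Notation h1p := (h1_plane P2q phi beta s n%:Z).
Local Notation h2p := (h2_plane phi beta s n%:Z).

Lemma hplane_twist_h1 i M : i \in V -> M \in unitmx ->
  h1p (hplane (twist kappa M) true dl (eps i) (alp i)).
Proof. by move=> iV uM; apply: (hplane_h1_plane hL th_nt (adapted_mul uM ad) s3 (frV iV)). Qed.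

Lemma hplane_twist_h2 i M : i \in V -> M \in unitmx ->
  h2p (hplane (twist kappa M) false dl (eps i) (alp i)).
Proof. by move=> iV uM; apply: (hplane_h2_plane hL th_nt (adapted_mul uM ad) s3 (frV iV)). Qed.

Lemma h_plane_types U : h_plane s U -> h1p U \/ h2p U.
Proof.
case/classif => -[] [i [M [iV uM ->]]]; first by left; exact: hplane_twist_h1.
by right; exact: hplane_twist_h2.
Qed.

Lemma count_h1 : has_card h1p (#|V| * (q + 1) * (q ^ 2 + q + 1))%N%:Z.
Proof.
apply: (count_planes ad (h1 := true) frV rigid) => [U|].
  split=> [h1U|[i [M [iV uM ->]]]]; last exact: hplane_twist_h1.
  case: (classif h1U.1) => -[] [i [M [iV uM eU]]]; first by exists i, M.
  by case: (@h1_h2_exclusive F L P2q phi beta s dl U); split=> //; rewrite eU; exact: hplane_twist_h2.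
rewrite card_GL3 card_stab1; have := finNzRing_gt1 F; move: #|F| #|V| => r v r1.
(* Writing q = t + 1 removes the truncated subtractions, so that [ring] applies. *)
have [t ->] : exists t, r = t.+1 by exists r.-1; lia.
have -> : (t.+1 - 1 = t)%N by lia.
have -> : (t.+1 ^ 2 - 1 = t * (t + 2))%N by lia.
have -> : (t.+1 ^ 3 - 1 = t * (t.+1 ^ 2 + t.+1 + 1))%N by lia.
ring.
Qed.

Lemma count_h2 : has_card h2p (#|V| * (q ^ 2 + n - 1) * (q ^ 2 + q + 1))%N%:Z.
Proof.
apply: (count_planes ad (h1 := false) frV rigid) => [U|].
  split=> [h2U|[i [M [iV uM ->]]]]; last exact: hplane_twist_h2.
  case: (classif h2U.1) => -[] [i [M [iV uM eU]]]; last by exists i, M.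
  by case: (@h1_h2_exclusive F L P2q phi beta s dl U); split=> //; rewrite eU; exact: hplane_twist_h1.
rewrite card_GL3; have := finNzRing_gt1 F.
have -> : #|[set G : 'M[F]_3 | (G \in unitmx) && stab false dl G]| =
  (if dl then (q - 1) ^ 2 * q ^ 3 else q * ((q - 1) * (q ^ 2 - 1)) * (q - 1))%N.
  by case: (dl); rewrite ?card_stab2_char3 ?card_stab2.
move: #|F| #|V| => r v r1.
have [t ->] : exists t, r = t.+1 by exists r.-1; lia.
have -> : (t.+1 - 1 = t)%N by lia.
have -> : (t.+1 ^ 3 - 1 = t * (t.+1 ^ 2 + t.+1 + 1))%N by lia.
case: (dl); rewrite /= ?addn0 ?addnK.
  have -> : (t.+1 ^ 2 - 1 = t * (t + 2))%N by lia.
  ring.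
ring.
Qed.
End Assembly.

Theorem theorem22 (F : finFieldType) (L : fieldExtType F)
  (hq : (2 < #|F|)%N) (hL : \dim {:L}%VS = 3%N)
  (n : int) (hn : n \in [:: -1; 0; 1]) (hqn : (#|F|%:Z = n %[mod 3])%Z)
  (P2q : {vspace 'rV[L]_3} -> Prop) (hP2q : Fq_subplane P2q)
  (phi : {vspace 'rV[L]_3} -> {vspace 'rV[L]_3})
  (hphi : collineation phi) (hphi3 : collineation_order3 phi)
  (hfix : forall P, P2q P -> phi P = P)
  (beta : 'rV[L]_3 -> 'rV[F]_9) (hbeta : F_identification beta)
  (s : 'End('rV[F]_9)) (hs3 : projectivity_order3 s)
  (hs : induced_by beta phi s) :
  let q := #|F|%:Z in
  let g := (gcdn 3 (#|F| - 1))%:Z in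
  ((q = -1 %[mod 3])%Z -> forall U, ~ h_plane s U) /\
  (~ (q = -1 %[mod 3])%Z ->
     (forall U, h_plane s U ->
        (h1_plane P2q phi beta s n U \/ h2_plane phi beta s n U) /\
        ~ (h1_plane P2q phi beta s n U /\ h2_plane phi beta s n U)) /\
     has_card (h1_plane P2q phi beta s n)
       (g * (n + 1) * (q + 1) * (q ^+ 2 + q + 1)) /\
     has_card (h2_plane phi beta s n)
       (g * (n + 1) * (q ^+ 2 + n - 1) * (q ^+ 2 + q + 1))).
Proof.
have [B uB P2qB] := hP2q; have s3 := s_cubed hs3.1.
have [th [kappa [th3 th_nt ad]]] :=
  adapted_exists uB P2qB hphi hphi3 hfix hbeta hs3.1 hs.
move=> q g; split=> [qm|qm].
  have q2 : #|F| = 2 %[mod 3] by move: qm; rewrite /q; lia.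
  apply: (no_h_plane hL th_nt ad s3); first exact: cube_root_trivial.
  by rewrite finField_char3 /dvdn q2.
case: (modz3_nat hqn hn) => -[en q3]; subst n; first by case: qm.
- have c3 : 3%:R = 0 :> F by apply/eqP; rewrite finField_char3 /dvdn q3.
  have [al thal] := th_artin_schreier th3 th_nt c3.
  (* There is a single frame, so |V| = 1 = g (n + 1). *)
  have frV (i : unit) : i \in [set: unit] -> frame th true 1 1 1 al.
    by move=> _; exact: frame_char3.
  have rigid (i i' : unit) : i \in [set: unit] -> i' \in [set: unit] ->
      (~~ true -> (1 : F) = 1 /\ (1 : F) = 1) -> i' = i by case: i; case: i'.
  have classif U : h_plane s U -> exists h1 (i : unit) M, [/\ i \in [set: unit],
      M \in unitmx & U = hplane (twist kappa M) h1 true 1 al].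
    case/(classification_char3 hL th_nt ad s3 c3 thal) => M uM [h1 e].
    by exists h1, tt, M; rewrite inE.
  have g1 : gcdn 3 (#|F| - 1) = 1%N.
    by apply/eqP; rewrite -/(coprime _ _) prime_coprime // /dvdn; move: q3 hq; lia.
  split=> [U hU|]; last split.
  + split; last exact: (@h1_h2_exclusive F L P2q phi beta s true U).
    exact: (h_plane_types hL th_nt ad s3 frV classif).
  + have := count_h1 hL th_nt ad s3 frV rigid classif.
    by rewrite cardsT card_unit /g g1 /q; congr has_card; lia.
  + have := count_h2 hL th_nt ad s3 frV rigid classif.
    by rewrite cardsT card_unit /g g1 /q; congr has_card; move: #|F| hq => r r1; nia.
have [w w2 w1] := cube_root_exists q3.
have [al al0 thal] := th_kummer th3 th_nt w2 w1.
(* The frames are indexed by the exponents of the ordered pair (mu, nu), so |V| = 6 = g (n + 1) with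
   g = 3 and n = 1. *)
pose V := [set jk : 'I_3 * 'I_3 | jk.1 != jk.2].
have frV (jk : 'I_3 * 'I_3) : jk \in V ->
    frame th false (w ^+ jk.1) (w ^+ jk.2) (al ^+ jk.1) (al ^+ jk.2).
  by rewrite inE => ne; exact: frame_kummer.
have rigid (i i' : 'I_3 * 'I_3) : i \in V -> i' \in V ->
    (~~ false -> w ^+ i'.1 = w ^+ i.1 /\ w ^+ i'.2 = w ^+ i.2) -> i' = i.
  move=> _ _ /(_ isT)[e1 e2]; case: i i' e1 e2 => [j k] [j' k'] /= e1 e2.
  by rewrite (root_exp_inj w2 w1 e1) (root_exp_inj w2 w1 e2).
have classif U : h_plane s U -> exists h1 (i : 'I_3 * 'I_3) M, [/\ i \in V,
    M \in unitmx & U = hplane (twist kappa M) h1 false (al ^+ i.1) (al ^+ i.2)].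
  case/(classification_kummer hL th_nt ad s3 w2 w1 al0 thal) => M uM [h1 [j [k [jk e]]]].
  by exists h1, (j, k), M; rewrite inE.
have cV : #|V| = 6%N.
  have := cardsC [set jk : 'I_3 * 'I_3 | jk.1 == jk.2].
  have -> : [set jk : 'I_3 * 'I_3 | jk.1 == jk.2] = [set (j, j) | j : 'I_3].
    apply/setP => -[j k]; rewrite inE; apply/eqP/imsetP => /= [->|[i _ [-> ->]] //].
    by exists k.
  rewrite card_imset; last by move=> j k [].
  have -> : ~: [set (j, j) | j : 'I_3] = V.
    apply/setP => -[j k]; rewrite !inE /=; congr (~~ _).
    by apply/imsetP/eqP => [[i _ [-> ->]] //|->]; exists k.
  by rewrite card_prod !card_ord => /(@addnI 3).
have g3 : gcdn 3 (#|F| - 1) = 3%N.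
  by apply/gcdn_idPl; rewrite /dvdn; move: q3 hq; lia.
split=> [U hU|]; last split.
+ split; last exact: (@h1_h2_exclusive F L P2q phi beta s false U).
  exact: (h_plane_types hL th_nt ad s3 frV classif).
+ have := count_h1 hL th_nt ad s3 frV rigid classif.
  by rewrite cV /g g3 /q; congr has_card; lia.
+ have := count_h2 hL th_nt ad s3 frV rigid classif.
  by rewrite cV /g g3 /q; congr has_card; move: #|F| hq => r r1; nia.
Qed.
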